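(* Let $f(q)=q+\sum_{n=2}^{+\infty}q^{n}a_{n}\in\mathcal{S}^{*}$ (with $a_n\in\mathbb{H}$). Then, for any $\lambda\in\mathbb{H}$, $$|a_{3}-\lambda a_{2}^{2}|\leq\max\{1,|4\lambda-3|\}.$$ This estimate is sharp for each $\lambda$. Equality occurs if $$f(q)=q(1-qu)^{-\ast2},\qquad q\in\mathbb{B},$$ for any $u\in\partial\mathbb{B}$.
   Context: $\mathbb{H}$ denotes the quaternions, $\mathbb{B}=\{q\in\mathbb{H}:|q|<1\}$, $\partial\mathbb{B}=\{q\in\mathbb{H}:|q|=1\}$, $\mathbb{S}=\{q\in\mathbb{H}:q^2=-1\}$; for $I\in\mathbb{S}$, $\mathbb{C}_I=\mathbb{R}\oplus I\mathbb{R}$ and $\mathbb{B}_I=\mathbb{B}\cap\mathbb{C}_I$. A function $f:\mathbb{B}\to\mathbb{H}$ is (left) slice regular if for every $I\in\mathbb{S}$ the restriction $f_I=f|_{\mathbb{B}_I}$ has continuous partial derivatives and $\frac12\left(\frac{\partial}{\partial x}+I\frac{\partial}{\partial y}\right)f_I(x+yI)=0$ on $\mathbb{B}_I$; such a function has a power series expansion $f(q)=\sum_{n\ge0}q^na_n$ on $\mathbb{B}$ with $a_n\in\mathbb{H}$. Its slice derivative is $f'(x+yI)=\frac12\left(\frac{\partial}{\partial x}-I\frac{\partial}{\partial y}\right)f_I(x+yI)$, i.e. $f'(q)=\sum_{n\ge1}q^{n-1}na_n$. For slice regular $f=\sum q^na_n$, $g=\sum q^nb_n$ on $\mathbb{B}$: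 the regular product is $f\ast g(q)=\sum_n q^n\sum_{k=0}^n a_kb_{n-k}$; the regular conjugate is $f^c(q)=\sum q^n\overline{a_n}$; the symmetrization is $f^s=f\ast f^c$; the regular reciprocal is $f^{-\ast}(q)=f^s(q)^{-1}f^c(q)$ off the zero set of $f^s$. $(1-qu)^{-\ast2}$ denotes $(1-qu)^{-\ast}\ast(1-qu)^{-\ast}$, so that $q(1-qu)^{-\ast2}=\sum_{n\ge1}n\,q^nu^{n-1}$. $\mathcal{S}$ is the set of slice regular $f:\mathbb{B}\to\mathbb{H}$ whose zero set is $\mathcal{Z}_f=\{0\}$ and with $f'(0)=1$. The class of slice starlike functions $\mathcal{S}^{*}$ is the set of $f\in\mathcal{S}$ such that $\mathrm{Re}\big(f(q)^{-1}qf'(q)\big)>0$ on $\mathbb{B}$ (pointwise products; at $q=0$ the expression is understood as its limit value $1$).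
   Formalization: The clause that equality occurs for f(q)=q(1-qu)^{-*2} is stated only when |4λ-3| ≥ 1; for |4λ-3| < 1 it is false, since there |a_3-λa_2^2| = |4λ-3| < 1 (e.g. λ=3/4 gives 0). Sharpness for every λ is kept. *)

(* Defs.v *)
From HB Require Import structures.
From mathcomp Require Import all_boot all_order all_algebra.
From mathcomp Require Import all_classical all_reals all_analysis.
From mathcomp Require Import ring lra.

Set Implicit Arguments.
Unset Strict Implicit.
Unset Printing Implicit Defensive.

Import Order.TTheory GRing.Theory Num.Theory.
Import numFieldNormedType.Exports.

Local Open Scope classical_set_scope.
Local Open Scope ring_scope.

Record quaternion (R : Type) := Quaternion { qre : R; qi : R; qj : R; qk : R }.

Definition quaternion_tuple (R : Type) (q : quaternion R) : R * R * R * R :=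
  (qre q, qi q, qj q, qk q).

Definition tuple_quaternion (R : Type) (t : R * R * R * R) : quaternion R :=
  Quaternion t.1.1.1 t.1.1.2 t.1.2 t.2.

Lemma quaternion_tupleK (R : Type) :
  cancel (@quaternion_tuple R) (@tuple_quaternion R).
Proof. by case. Qed.

Section QuaternionAlgebra.
Variable R : realType.
Implicit Types p q r : quaternion R.

HB.instance Definition _ :=
  Choice.copy (quaternion R) (can_type (@quaternion_tupleK R)).

Lemma quaternionP p q :
  p = q <-> [/\ qre p = qre q, qi p = qi q, qj p = qj q & qk p = qk q].
Proof.
split=> [-> //|]; case: p => ? ? ? ?; case: q => ? ? ? ? /= [].
by move=> -> -> -> ->.
Qed.

Definition quaternion_add p q : quaternion R :=
  Quaternion (qre p + qre q) (qi p + qi q) (qj p + qj q) (qk p + qk q).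

Definition quaternion_opp q : quaternion R :=
  Quaternion (- qre q) (- qi q) (- qj q) (- qk q).

Let addA : associative quaternion_add.
Proof. by move=> p q r; apply/quaternionP; split=> /=; ring. Qed.
Let addC : commutative quaternion_add.
Proof. by move=> p q; apply/quaternionP; split=> /=; ring. Qed.
Let add0 : left_id (Quaternion 0 0 0 0) quaternion_add.
Proof. by move=> p; apply/quaternionP; split=> /=; ring. Qed.
Let addN : left_inverse (Quaternion 0 0 0 0) quaternion_opp quaternion_add.
Proof. by move=> p; apply/quaternionP; split=> /=; ring. Qed.

HB.instance Definition _ :=
  GRing.isZmodule.Build (quaternion R) addA addC add0 addN.

Definition quaternion_mul p q : quaternion R :=
  Quaternion
    (qre p * qre q - qi p * qi q - qj p * qj q - qk p * qk q)
    (qre p * qi q + qi p * qre q + qj p * qk q - qk p * qj q)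
    (qre p * qj q - qi p * qk q + qj p * qre q + qk p * qi q)
    (qre p * qk q + qi p * qj q - qj p * qi q + qk p * qre q).

Let mulA : associative quaternion_mul.
Proof. by move=> p q r; apply/quaternionP; split=> /=; ring. Qed.
Let mul1 : left_id (Quaternion 1 0 0 0) quaternion_mul.
Proof. by move=> p; apply/quaternionP; split=> /=; ring. Qed.
Let mulq1 : right_id (Quaternion 1 0 0 0) quaternion_mul.
Proof. by move=> p; apply/quaternionP; split=> /=; ring. Qed.
Let mulDl : left_distributive quaternion_mul +%R.
Proof. by move=> p q r; apply/quaternionP; split=> /=; ring. Qed.
Let mulDr : right_distributive quaternion_mul +%R.
Proof. by move=> p q r; apply/quaternionP; split=> /=; ring. Qed.
Let one_neq0 : Quaternion 1 0 0 0 != 0 :> quaternion R.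
Proof. by apply/eqP => -[] /eqP; rewrite oner_eq0. Qed.

HB.instance Definition _ := GRing.Zmodule_isNzRing.Build (quaternion R)
  mulA mul1 mulq1 mulDl mulDr one_neq0.

Definition quaternion_scale (a : R) q : quaternion R :=
  Quaternion (a * qre q) (a * qi q) (a * qj q) (a * qk q).

Let scaleA a b q :
  quaternion_scale a (quaternion_scale b q) = quaternion_scale (a * b) q.
Proof. by apply/quaternionP; split=> /=; ring. Qed.
Let scale1 : left_id 1 quaternion_scale.
Proof. by move=> p; apply/quaternionP; split=> /=; ring. Qed.
Let scaleDr : right_distributive quaternion_scale +%R.
Proof. by move=> a p q; apply/quaternionP; split=> /=; ring. Qed.
Let scaleDl q : {morph quaternion_scale^~ q : a b / a + b}.
Proof. by move=> a b; apply/quaternionP; split=> /=; ring. Qed.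

HB.instance Definition _ := GRing.Zmodule_isLmodule.Build R (quaternion R)
  scaleA scale1 scaleDr scaleDl.

Let scaleAl (a : R) p q : a *: (p * q) = (a *: p) * q.
Proof. by apply/quaternionP; split=> /=; ring. Qed.
Let scaleAr (a : R) p q : a *: (p * q) = p * (a *: q).
Proof. by apply/quaternionP; split=> /=; ring. Qed.

HB.instance Definition _ :=
  GRing.Lmodule_isLalgebra.Build R (quaternion R) scaleAl.
HB.instance Definition _ :=
  GRing.Lalgebra_isAlgebra.Build R (quaternion R) scaleAr.

Definition qconj q : quaternion R :=
  Quaternion (qre q) (- qi q) (- qj q) (- qk q).

Definition qsqnorm q : R := qre q ^+ 2 + qi q ^+ 2 + qj q ^+ 2 + qk q ^+ 2.

Lemma qsqnorm_ge0 q : 0 <= qsqnorm q.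
Proof. by rewrite !addr_ge0 ?sqr_ge0. Qed.

Lemma qsqnorm_eq0 q : qsqnorm q = 0 -> q = 0.
Proof.
move/eqP; rewrite /qsqnorm !paddr_eq0 ?addr_ge0 ?sqr_ge0 // !sqrf_eq0.
by case/andP=> /andP[/andP[/eqP ? /eqP ?] /eqP ?] /eqP ?; apply/quaternionP.
Qed.

Definition quaternion_inv q : quaternion R := (qsqnorm q)^-1 *: qconj q.

Lemma mul_qconj q : q * qconj q = (qsqnorm q)%:A.
Proof. by rewrite /qsqnorm; apply/quaternionP; split=> /=; ring. Qed.

Lemma qconj_mul q : qconj q * q = (qsqnorm q)%:A.
Proof. by rewrite /qsqnorm; apply/quaternionP; split=> /=; ring. Qed.

Let mulV : {in [pred q | q != 0], left_inverse 1 quaternion_inv *%R}.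
Proof.
move=> q; rewrite inE => q0; rewrite /quaternion_inv -scalerAl qconj_mul.
rewrite scalerA mulVf ?scale1r //.
by apply: contra_neq q0; exact: qsqnorm_eq0.
Qed.
Let divV : {in [pred q | q != 0], right_inverse 1 quaternion_inv *%R}.
Proof.
move=> q; rewrite inE => q0; rewrite /quaternion_inv -scalerAr mul_qconj.
rewrite scalerA mulVf ?scale1r //.
by apply: contra_neq q0; exact: qsqnorm_eq0.
Qed.
Let unitP p q : q * p = 1 /\ p * q = 1 -> p \in [pred q | q != 0].
Proof.
move=> [qp _]; rewrite inE; apply/eqP => p0.
by move/eqP: qp; rewrite p0 mulr0 eq_sym oner_eq0.
Qed.
Let inv_out : {in [predC [pred q | q != 0]], quaternion_inv =1 id}.
Proof.
move=> q; rewrite !inE negbK => /eqP ->.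
by apply/quaternionP; split=> /=; ring.
Qed.

HB.instance Definition _ := GRing.NzRing_hasMulInverse.Build (quaternion R)
  mulV divV unitP inv_out.

Definition qnorm q : R := Num.sqrt (qsqnorm q).

Let qnormD p q : qnorm (p + q) <= qnorm p + qnorm q.
Proof.
have pq_ge0 : 0 <= qnorm p + qnorm q by rewrite addr_ge0 ?sqrtr_ge0.
rewrite -(ler_pXn2r (n := 2)) ?nnegrE ?sqrtr_ge0 //.
rewrite sqrrD !sqr_sqrtr ?qsqnorm_ge0 //.
set d := qre p * qre q + qi p * qi q + qj p * qj q + qk p * qk q.
have -> : qsqnorm (p + q) = qsqnorm p + d *+ 2 + qsqnorm q.
  by rewrite /qsqnorm /d /=; ring.
rewrite lerD2r lerD2l lerMn2r /=; apply: le_trans (ler_norm d) _.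
rewrite -(ler_pXn2r (n := 2)) ?nnegrE ?mulr_ge0 ?sqrtr_ge0 //.
rewrite exprMn !sqr_sqrtr ?qsqnorm_ge0 // real_normK ?num_real // -subr_ge0.
have -> : qsqnorm p * qsqnorm q - d ^+ 2 =
    (qre p * qi q - qi p * qre q) ^+ 2 + (qre p * qj q - qj p * qre q) ^+ 2 +
    (qre p * qk q - qk p * qre q) ^+ 2 + (qi p * qj q - qj p * qi q) ^+ 2 +
    (qi p * qk q - qk p * qi q) ^+ 2 + (qj p * qk q - qk p * qj q) ^+ 2.
  by rewrite /qsqnorm /d; ring.
by rewrite !addr_ge0 ?sqr_ge0.
Qed.
Let qnormZ (a : R) q : qnorm (a *: q) = `|a| * qnorm q.
Proof.
have -> : qnorm (a *: q) = Num.sqrt (a ^+ 2 * qsqnorm q).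
  by congr Num.sqrt; rewrite /qsqnorm /=; ring.
by rewrite sqrtrM ?sqr_ge0 // sqrtr_sqr.
Qed.
Let qnorm_eq0 q : qnorm q = 0 -> q = 0.
Proof.
move/eqP; rewrite sqrtr_eq0 => q_le0.
by apply/qsqnorm_eq0/le_anti; rewrite q_le0 qsqnorm_ge0.
Qed.

HB.instance Definition _ := Lmodule_isNormed.Build R (quaternion R)
  qnormD qnormZ qnorm_eq0.

Lemma qnormE q :
  `|q| = Num.sqrt (qre q ^+ 2 + qi q ^+ 2 + qj q ^+ 2 + qk q ^+ 2).
Proof. by []. Qed.

End QuaternionAlgebra.

(* A function on the unit ball is represented by a total function on the
   quaternions; every notion below depends only on its values on the ball. *)
Section SliceRegular.
Variable R : realType.
Local Notation H := (quaternion R).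
Implicit Types (f g : H -> H) (a b : nat -> H) (I q u : H) (x y : R).

Definition qball : set H := [set q | `|q| < 1].

Definition qimag_units : set H := [set I | I ^+ 2 = -1].

Definition slice_pt I x y : H := x%:A + y *: I.

Definition slice_dx f I x y : H := (fun t => f (slice_pt I t y))^`()%classic x.
Definition slice_dy f I x y : H := (fun t => f (slice_pt I x t))^`()%classic y.

(* [derive1] is total, so the existence of the partial derivatives is a separate
   clause; the unit disk being open, continuity on it is pointwise. *)
Definition slice_C1 f I := forall x y, qball (slice_pt I x y) ->
  [/\ derivable (fun t => f (slice_pt I t y)) x 1,
      derivable (fun t => f (slice_pt I x t)) y 1,
      {for (x, y), continuous (fun z : R * R => slice_dx f I z.1 z.2)} &
      {for (x, y), continuous (fun z : R * R => slice_dy f I z.1 z.2)}].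

Definition slice_regular f := forall I, qimag_units I ->
  slice_C1 f I /\
  forall x y, qball (slice_pt I x y) ->
    2^-1 *: (slice_dx f I x y + I * slice_dy f I x y) = 0.

(* The value f'(x + yI), as a function of the representation (I, x, y). *)
Definition slice_deriv f I x y : H :=
  2^-1 *: (slice_dx f I x y - I * slice_dy f I x y).

Definition qzeros f : set H := [set q | qball q /\ f q = 0].

Definition class_S f :=
  [/\ slice_regular f, qzeros f = [set 0] &
      forall I, qimag_units I -> slice_deriv f I 0 0 = 1].

(* The condition at q = 0 is the limit value 1, whose real part is positive. *)
Definition slice_starlike f :=
  class_S f /\
  forall I x y, qimag_units I -> let q := slice_pt I x y in
    qball q -> q != 0 -> 0 < qre ((f q)^-1 * q * slice_deriv f I x y).

Definition has_qseries f a := forall q, qball q ->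
  series (fun n => q ^+ n * a n) @ \oo --> f q.

(* The coefficient sequence of f; it is unique when it exists. *)
Definition qcoef f : nat -> H := xget (fun=> 0) [set a | has_qseries f a].

Definition qseries a q : H := limn (series (fun n => q ^+ n * a n)).

Definition regular_mul f g : H -> H :=
  qseries (fun n => \sum_(k < n.+1) qcoef f k * qcoef g (n - k)%N).

Definition regular_conj f : H -> H := qseries (fun n => qconj (qcoef f n)).

Definition symmetrization f : H -> H := regular_mul f (regular_conj f).

Definition regular_inv f q : H := (symmetrization f q)^-1 * regular_conj f q.

Definition slice_koebe u q : H :=
  let h := regular_inv (fun p => 1 - p * u) in q * regular_mul h h q.

End SliceRegular.

(* Main.v *)
(* For f = q h slice starlike, positivity of Re(f^{-1} q f') on every slice says that
   the Hermitian part of f' conj(h), read in the complexified quaternions (2x2 complex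
   matrices), is positive on circles. Truncating h after a compactness argument, and
   inverting h through the real polynomial h^c h (each zero of which produces one of h), this
   positivity passes to the coefficients p_n of the regular quotient
   h^{-*} * f' = 1 + q p_1 + q^2 p_2 + ... : their 3x3 quaternionic Toeplitz matrix is
   nonnegative, so |p_2 - p_1^2 / 2| <= 2 - |p_1|^2 / 2. Since p_1 = a_2 and
   p_2 = 2 a_3 - a_2^2, this is |a_3 - (3/4) a_2^2| <= 1 - |a_2|^2 / 4, and the estimate
   for every lambda follows from the triangle inequality.
   For the Koebe function with u = x + yJ and q in C_I, the elements
   (1 -+ IJ)/2 turn right powers of u into left powers of x +- yI, which reduces
   positivity to that of the complex kernel (1 + w)/(1 - w) at two points. *)
Require Import Defs.
From HB Require Import structures.
From mathcomp Require Import all_boot all_order all_algebra.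
From mathcomp Require Import all_classical all_reals all_analysis.
From mathcomp Require Import complex ring lra.

Import Order.TTheory GRing.Theory Num.Theory.
Import numFieldNormedType.Exports.

Local Open Scope classical_set_scope.
Local Open Scope ring_scope.
Set Implicit Arguments.
Unset Strict Implicit.
Unset Printing Implicit Defensive.

(** * Quaternions and slices *)

(** The obstacle is that $f^{-1}qf'$ is a pointwise expression. In general it is not slice regular,
    so it has no power series to which the classical coefficient bounds for functions of positive
    real part apply. The regular quotient has such a series, but its values are not those in the
    hypothesis. The link is that on a sphere $x+y\mathbb{S}$ both $h$ and $f'$ have the form $a+Ib$
    with $a,b$ independent of $I$: these are the two parts of evaluation at the complex number
    $x+iy$. Unlike evaluation at a quaternion, this one is multiplicative for the regular product,
    so the inequality obtained from all $I$ can be tested against an arbitrary polynomial factor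
    $W$. Sums over roots of unity replace integrals over circles and are exact for polynomials.
    Inverting needs a polynomial without zeros on the closed ball, so $h$ is first dilated to
    $h(rq)$ with $r<1$; the functional $a_3-\lambda a_2^2$ is homogeneous, so this costs only a
    factor $r^2$, removed at the end. *)

Section Quaternions.
Variable R : realType.
Local Notation H := (quaternion R).
Implicit Types (p q r I : H) (x y : R).

Lemma qconjD p q : qconj (p + q) = qconj p + qconj q.
Proof. by apply/quaternionP; split=> /=; ring. Qed.

Lemma qconj0 : qconj 0 = 0 :> H.
Proof. by apply/quaternionP; split=> /=; ring. Qed.

HB.instance Definition _ :=
  GRing.isNmodMorphism.Build H H (@qconj R) (conj qconj0 qconjD).

HB.instance Definition _ :=
  GRing.isNmodMorphism.Build H R (@qre R) (conj erefl (fun _ _ => erefl)).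

Lemma qconj1 : qconj 1 = 1 :> H.
Proof. by apply/quaternionP; split=> /=; ring. Qed.

Lemma qconjM p q : qconj (p * q) = qconj q * qconj p.
Proof. by apply/quaternionP; split=> /=; ring. Qed.

Lemma qconjZ x q : qconj (x *: q) = x *: qconj q.
Proof. by apply/quaternionP; split=> /=; ring. Qed.

Lemma qconjK q : qconj (qconj q) = q.
Proof. by apply/quaternionP; split=> /=; ring. Qed.

Lemma qreZ x q : qre (x *: q) = x * qre q. Proof. by []. Qed.

Lemma qreMC p q : qre (p * q) = qre (q * p).
Proof. by rewrite /=; ring. Qed.

Lemma qnorm_sqr q : `|q| ^+ 2 = qsqnorm q.
Proof. by rewrite qnormE sqr_sqrtr // qsqnorm_ge0. Qed.

Lemma qre_mul_conj q : qre (qconj q * q) = `|q| ^+ 2.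
Proof. by rewrite qnorm_sqr /qsqnorm /=; ring. Qed.

Lemma qconj_mul_norm q : qconj q * q = (`|q| ^+ 2)%:A.
Proof. by rewrite qnorm_sqr qconj_mul. Qed.

Lemma qmul_conj_norm q : q * qconj q = (`|q| ^+ 2)%:A.
Proof. by rewrite qnorm_sqr mul_qconj. Qed.

Lemma qnormM p q : `|p * q| = `|p| * `|q|.
Proof.
apply/eqP; rewrite -(eqrXn2 (n := 2)) ?mulr_ge0 // exprMn !qnorm_sqr.
by rewrite /qsqnorm /=; apply/eqP; ring.
Qed.

Lemma qnorm1 : `|1 : H| = 1.
Proof.
by apply/eqP; rewrite -(eqrXn2 (n := 2)) // qnorm_sqr /qsqnorm /=; apply/eqP; ring.
Qed.

Lemma qnormX q n : `|q ^+ n| = `|q| ^+ n.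
Proof. by elim: n => [|n IH]; rewrite ?expr0 ?qnorm1 // !exprS qnormM IH. Qed.

Lemma qnorm_conj q : `|qconj q| = `|q|.
Proof.
apply/eqP; rewrite -(eqrXn2 (n := 2)) // !qnorm_sqr.
by rewrite /qsqnorm /=; apply/eqP; ring.
Qed.

Lemma qnormA x : `|x%:A : H| = `|x|.
Proof. by rewrite normrZ qnorm1 mulr1. Qed.

Lemma qre_norm q : `|qre q| <= `|q|.
Proof.
rewrite -(ler_pXn2r (n := 2)) ?nnegrE // qnorm_sqr real_normK ?num_real //.
by rewrite /qsqnorm -!addrA lerDl !addr_ge0 ?sqr_ge0.
Qed.

Lemma qre_le q : qre q <= `|q|.
Proof. exact: le_trans (ler_norm _) (qre_norm q). Qed.

Lemma qunitE q : (q \is a GRing.unit) = (q != 0).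
Proof. by []. Qed.

Lemma qnormV q : `|q^-1| = `|q|^-1.
Proof.
have [->|q0] := eqVneq q 0; first by rewrite invr0 normr0 invr0.
apply: (@mulfI _ `|q|); first by rewrite normr_eq0.
by rewrite -qnormM !divrr ?qnorm1 // unitfE normr_eq0.
Qed.

Lemma qmulf_eq0 p q : (p * q == 0) = (p == 0) || (q == 0).
Proof. by rewrite -[LHS]normr_eq0 qnormM mulf_eq0 !normr_eq0. Qed.

Lemma qscaleC x q : x%:A * q = q * x%:A.
Proof. by rewrite -scalerAl mul1r -scalerAr mulr1. Qed.

Lemma imag_unitP I : qimag_units I <-> qre I = 0 /\ `|I| = 1.
Proof.
rewrite /qimag_units /=; split=> [/quaternionP[]|[I0 /eqP]].
  rewrite /= => e1 e2 e3 e4.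
  have n1 : `|I| ^+ 2 = 1.
    have I2 : I ^+ 2 = -1 by apply/quaternionP.
    by rewrite -qnormX I2 normrN qnorm1.
  have nI : `|I| = 1 by apply/eqP; rewrite -(eqrXn2 (n := 2)) ?expr1n // n1.
  split=> //; move: n1; rewrite qnorm_sqr /qsqnorm => n1.
  (* Writing $v$ for the imaginary part, the real part of [I ^+ 2] gives $\mathrm{re}^2-|v|^2=-1$,
     and the norm gives $\mathrm{re}^2+|v|^2=1$. *)
  have : qre I ^+ 2 = 0 by nra.
  by move/eqP; rewrite sqrf_eq0 => /eqP.
rewrite -(eqrXn2 (n := 2)) // expr1n qnorm_sqr /qsqnorm I0 => /eqP n1.
by apply/quaternionP; split=> /=; rewrite ?I0; nra.
Qed.

Definition iunit : H := Quaternion 0 1 0 0.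

Lemma imag_iunit : qimag_units iunit.
Proof. by apply/quaternionP; split=> /=; ring. Qed.

Lemma imag_conj I : qimag_units I -> qconj I = - I.
Proof. by case/imag_unitP => I0 _; apply/quaternionP; split => //=; rewrite I0 oppr0. Qed.

Lemma imag_opp I : qimag_units I -> qimag_units (- I).
Proof. by rewrite /qimag_units /= sqrrN. Qed.

Lemma slice_ptM I x y x' y' : qimag_units I ->
  slice_pt I x y * slice_pt I x' y' = slice_pt I (x * x' - y * y') (x * y' + y * x').
Proof.
rewrite /qimag_units /= expr2 => I2; rewrite /slice_pt mulrDl !mulrDr.
rewrite -!scalerAl -!scalerAr !mul1r mulr1 I2 !scalerA scalerN scalerBl scalerDl.
by rewrite [y * x']mulrC !addrA; apply/quaternionP; split=> /=; ring.
Qed.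

Lemma slice_pt_comm I x y x' y' :
  slice_pt I x y * slice_pt I x' y' = slice_pt I x' y' * slice_pt I x y.
Proof. by apply/quaternionP; split=> /=; ring. Qed.

Lemma qre_slice I x y : qimag_units I -> qre (slice_pt I x y) = x.
Proof. by case/imag_unitP => I0 _ /=; rewrite I0; ring. Qed.

Lemma slice_conj I x y : qimag_units I -> qconj (slice_pt I x y) = slice_pt I x (- y).
Proof.
by case/imag_unitP => I0 _; apply/quaternionP; split => /=; rewrite ?I0; ring.
Qed.

Lemma slice_norm I x y : qimag_units I -> `|slice_pt I x y| ^+ 2 = x ^+ 2 + y ^+ 2.
Proof.
move=> hI; rewrite -qre_mul_conj slice_conj // slice_ptM // qre_slice //; ring.
Qed.

Lemma imag_of_im q : qre q = 0 -> q != 0 -> qimag_units (`|q|^-1 *: q).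
Proof.
move=> q0 qn0; apply/imag_unitP; rewrite qreZ q0 mulr0; split=> //.
by rewrite normrZ normfV normr_id mulVf // normr_eq0.
Qed.

Lemma slice_ptP q : exists I x y, qimag_units I /\ q = slice_pt I x y.
Proof.
have [q0|q0] := eqVneq (q - (qre q)%:A) 0.
  exists iunit, (qre q), 0; split; first exact: imag_iunit.
  by rewrite /slice_pt scale0r addr0; apply/eqP; rewrite -subr_eq0 q0.
have r0 : qre (q - (qre q)%:A) = 0 by rewrite /=; ring.
exists (`|q - (qre q)%:A|^-1 *: (q - (qre q)%:A)), (qre q), `|q - (qre q)%:A|.
split; first exact: imag_of_im.
by rewrite /slice_pt scalerA divff ?normr_eq0 // scale1r addrC subrK.
Qed.

(** Since $(qp)^{-1}q=p^{-1}=\bar p/|p|^2$, the starlikeness condition for $f=qh$ has the sign of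
    $\mathrm{Re}(\bar h f')$, which involves no inverse and is continuous in the values. *)
Lemma qre_quotient_gt0 q p r : q != 0 -> p != 0 ->
  (0 < qre ((q * p)^-1 * q * r)) = (0 < qre (qconj p * r)).
Proof.
move=> q0 p0; rewrite invrM ?qunitE // mulrVK ?qunitE //.
rewrite -[p^-1]/((qsqnorm p)^-1 *: qconj p) -scalerAl qreZ.
by rewrite pmulr_rgt0 // invr_gt0 -qnorm_sqr exprn_gt0 // normr_gt0.
Qed.

End Quaternions.

(** * From positivity on all slices to a Hermitian inequality *)

Section SlicePairing.
Variable R : realType.
Local Notation H := (quaternion R).
Implicit Types (p q I : H).

(* In the complexified quaternions put [A = a + i b], [G = g + i d], [W = w + i v].
   The conclusion is the real part of [W' (G A' + A G') W], with ['] the adjoint; the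
   trace-free part of the 2x2 Hermitian matrix [G A' + A G'] is a vector of R^3, so
   ranging over all imaginary units [I] in the hypothesis tests its positivity. *)
Lemma slice_pairing_ge0 (a b g d w v : H) :
  (forall I, qimag_units I -> 0 <= qre (qconj (a + I * b) * (g + I * d))) ->
  0 <= qre (qconj (qconj g * w - qconj d * v) * (qconj a * w - qconj b * v)) +
       qre (qconj (qconj g * v + qconj d * w) * (qconj a * v + qconj b * w)).
Proof.
move=> pos.
pose S := qre (qconj g * a) + qre (qconj d * b).
pose L := g * qconj b - d * qconj a.
pose K := w * qconj v - (qre (w * qconj v))%:A.
have -> : qre (qconj (qconj g * w - qconj d * v) * (qconj a * w - qconj b * v)) +
       qre (qconj (qconj g * v + qconj d * w) * (qconj a * v + qconj b * w)) =
    (`|w| ^+ 2 + `|v| ^+ 2) * S + (qre (L * K)) *+ 2.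
  by rewrite !qnorm_sqr /qsqnorm /S /L /K /=; ring.
have posI I : qimag_units I -> qre (L * I) <= S.
  move=> hI; move: (pos I hI); case/imag_unitP: (hI) => I0 /(congr1 (fun x => x ^+ 2)).
  rewrite expr1n qnorm_sqr /qsqnorm I0 => nI.
  have -> : qre (qconj (a + I * b) * (g + I * d)) = S - qre (L * I).
    transitivity (qre (qconj g * a) + (0 ^+ 2 + qi I ^+ 2 + qj I ^+ 2 + qk I ^+ 2) *
                  qre (qconj d * b) - qre (L * I)); last by rewrite nI mul1r.
    by rewrite /L /= I0; ring.
  by rewrite subr_ge0.
have S0 : 0 <= S.
  have := posI _ (imag_iunit R); have := posI _ (imag_opp (imag_iunit R)).
  by rewrite mulrN /=; lra.
have wv : `|w| * `|v| *+ 2 <= `|w| ^+ 2 + `|v| ^+ 2.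
  by have := sqr_ge0 (`|w| - `|v|); rewrite -subr_ge0; nra.
have [K0|K0] := eqVneq K 0.
  by rewrite K0 mulr0 /= mul0rn addr0 mulr_ge0 // addr_ge0 ?sqr_ge0.
have rK : qre K = 0 by rewrite /K /=; ring.
have nK : `|K| <= `|w| * `|v|.
  rewrite -(qnorm_conj v) -qnormM -(ler_pXn2r (n := 2)) ?nnegrE // !qnorm_sqr.
  by rewrite /K /qsqnorm /= -subr_ge0; set x := (X in 0 <= X);
    have -> : x = (qre (w * qconj v)) ^+ 2;
    [rewrite /x /=; ring | exact: sqr_ge0].
(* The worst unit is the one opposite to [K]: it gives $\mathrm{Re}(LK)\ge-|K|S$, and
   $2|K|\le2|w||v|\le|w|^2+|v|^2$ concludes. *)
have := posI _ (imag_opp (imag_of_im rK K0)).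
have -> : qre (L * - (`|K|^-1 *: K)) = - qre (L * K) / `|K|.
  by rewrite mulrN -scalerAr /=; ring.
have n0 : 0 < `|K| by rewrite normr_gt0.
rewrite ler_pdivrMr // => h.
nra.
Qed.

End SlicePairing.

(** * Evaluation of quaternionic polynomials at complex numbers *)

Section PolySlice.
Variable R : realType.
Local Notation H := (quaternion R).
Implicit Types (p q : {poly H}) (c : nat -> R) (z : R[i]).

Definition wsum c p : H := \sum_(k < size p) c k *: p`_k.

Lemma wsum_widen c p n : (size p <= n)%N -> wsum c p = \sum_(k < n) c k *: p`_k.
Proof.
move=> le; rewrite /wsum (big_ord_widen n (fun k => c k *: p`_k)) //.
rewrite big_mkcond; apply: eq_bigr => k _; case: ltnP => // ?.
by rewrite nth_default // scaler0.
Qed.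

Lemma wsumD c p q : wsum c (p + q) = wsum c p + wsum c q.
Proof.
pose n := maxn (size p) (size q).
rewrite (wsum_widen c (n := n)) ?size_polyD //.
rewrite (@wsum_widen c p n) ?leq_maxl // (@wsum_widen c q n) ?leq_maxr //.
by rewrite -big_split; apply: eq_bigr => k _; rewrite coefD scalerDr.
Qed.

Lemma wsumX c p : wsum c (p * 'X) = wsum (fun k => c k.+1) p.
Proof.
rewrite (wsum_widen c (n := (size p).+1)); last first.
  by rewrite (leq_trans (size_polyMleq _ _)) // size_polyX addn2.
rewrite big_ord_recl coefMX scaler0 add0r; apply: eq_bigr => k _.
by rewrite coefMX.
Qed.

Lemma wsum_mulC c (d : H) p : wsum c (d%:P * p) = d * wsum c p.
Proof.
rewrite (wsum_widen c (n := size p)); last first.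
  rewrite (leq_trans (size_polyMleq _ _)) // (leq_trans (n := (1 + size p).-1)%N) //.
  by rewrite -!subn1 leq_sub2r // leq_add2r size_polyC leq_b1.
rewrite mulr_sumr; apply: eq_bigr => k _.
by rewrite coefCM scalerAr.
Qed.

(** With [ieval], the two parts of the value at $z$ in the complexified quaternions, where $z$ is
    central. For $z=x+iy$ they are the $a$ and $b$ of the representation $p(x+yI)=a+Ib$, the same
    for every [I]. *)
Definition reval z := wsum (fun k => complex.Re (z ^+ k)).
Definition ieval z := wsum (fun k => complex.Im (z ^+ k)).

Lemma revalX z p :
  reval z (p * 'X) = complex.Re z *: reval z p - complex.Im z *: ieval z p.
Proof.
rewrite /reval /ieval wsumX !scaler_sumr -sumrB; apply: eq_bigr => k _.
by rewrite exprS; case: z (z ^+ k) => x y [s t] /=; rewrite scalerBl !scalerA.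
Qed.

Lemma ievalX z p :
  ieval z (p * 'X) = complex.Re z *: ieval z p + complex.Im z *: reval z p.
Proof.
rewrite /reval /ieval wsumX !scaler_sumr -big_split; apply: eq_bigr => k _.
by rewrite exprS; case: z (z ^+ k) => x y [s t] /=; rewrite scalerDl !scalerA.
Qed.

Lemma revalC z (d : H) : reval z d%:P = d.
Proof.
rewrite /reval (wsum_widen _ (n := 1)) ?size_polyC ?leq_b1 //.
by rewrite big_ord1 coefC scale1r.
Qed.

Lemma ievalC z (d : H) : ieval z d%:P = 0.
Proof.
rewrite /ieval (wsum_widen _ (n := 1)) ?size_polyC ?leq_b1 //.
by rewrite big_ord1 scale0r.
Qed.

(** Complex scalars commute with quaternionic coefficients, so this evaluation respects the product
    of [{poly H}], which is the regular product; [seval] does not. *)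
Lemma evalM z p q :
  reval z (p * q) = reval z p * reval z q - ieval z p * ieval z q /\
  ieval z (p * q) = reval z p * ieval z q + ieval z p * reval z q.
Proof.
elim/poly_ind: p => [|p d [IHr IHi]].
  by rewrite !mul0r -polyC0 revalC ievalC !mul0r subr0 addr0.
rewrite mulrDl -mulrA -commr_polyX mulrA.
have -> : reval z (p * q * 'X + d%:P * q) = reval z (p * q * 'X) + d * reval z q.
  by rewrite /reval wsumD wsum_mulC.
have -> : ieval z (p * q * 'X + d%:P * q) = ieval z (p * q * 'X) + d * ieval z q.
  by rewrite /ieval wsumD wsum_mulC.
have -> : reval z (p * 'X + d%:P) = reval z (p * 'X) + d.
  by rewrite -[in RHS](revalC z d) /reval wsumD.
have -> : ieval z (p * 'X + d%:P) = ieval z (p * 'X).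
  by rewrite -[RHS]addr0 -[in RHS](ievalC z d) /ieval wsumD.
rewrite !revalX !ievalX IHr IHi.
move: (reval z p) (reval z q) (ieval z p) (ieval z q) => a b c e.
by case: z {IHr IHi} => x y; split; apply/quaternionP; split=> /=; ring.
Qed.

Lemma revalM z p q :
  reval z (p * q) = reval z p * reval z q - ieval z p * ieval z q.
Proof. by have [] := evalM z p q. Qed.

Lemma ievalM z p q :
  ieval z (p * q) = reval z p * ieval z q + ieval z p * reval z q.
Proof. by have [] := evalM z p q. Qed.

Lemma slice_ptX (I : H) z n : qimag_units I ->
  slice_pt I (complex.Re z) (complex.Im z) ^+ n =
  slice_pt I (complex.Re (z ^+ n)) (complex.Im (z ^+ n)).
Proof.
move=> hI; elim: n => [|n IH].
  by rewrite !expr0 /slice_pt /= scale1r scale0r addr0.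
by rewrite !exprS IH slice_ptM //; case: z (z ^+ n) {IH} => x y [].
Qed.

Definition seval p (q : H) : H := \sum_(k < size p) q ^+ k * p`_k.

Lemma seval_slice (I : H) z p : qimag_units I ->
  seval p (slice_pt I (complex.Re z) (complex.Im z)) = reval z p + I * ieval z p.
Proof.
move=> hI; rewrite /seval /reval /ieval /wsum mulr_sumr -big_split.
apply: eq_bigr => k _; rewrite slice_ptX // /slice_pt mulrDl.
by rewrite -!scalerAl mul1r -scalerAr.
Qed.

Definition rconj p : {poly H} := map_poly (@qconj R) p.

Lemma coef_rconj p k : (rconj p)`_k = qconj p`_k.
Proof. exact: coef_map. Qed.

(** Real weights commute with conjugation. Hence regular conjugation conjugates both [reval] and
    [ieval], without changing the sign of the imaginary unit of [R[i]]. *)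
Lemma wsum_rconj c p : wsum c (rconj p) = qconj (wsum c p).
Proof.
rewrite (wsum_widen c (n := size p)) ?size_poly // /wsum raddf_sum.
by apply: eq_bigr => k _; rewrite coef_rconj -qconjZ.
Qed.

End PolySlice.

(** * Roots of unity and a discrete Parseval identity *)

Section RootsOfUnity.
Variable R : realType.
Local Notation H := (quaternion R).
Implicit Types (p q U V W : {poly H}) (t : R).

(** Dirichlet's telescoping: $2\cos(jt)\sin(t/2)=\sin((j+\frac12)t)-\sin((j-\frac12)t)$. *)
Lemma sum_cos_mul_sin t n :
  (\sum_(j < n) cos (j%:R * t)) * (2 * sin (t / 2)) =
  sin (n%:R * t - t / 2) + sin (t / 2).
Proof.
elim: n => [|n IH]; first by rewrite big_ord0 mul0r mul0r add0r sinN addNr.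
rewrite big_ord_recr /= mulrDl IH -(natr1 n).
have -> : (n%:R + 1) * t - t / 2 = n%:R * t + t / 2 by field.
by rewrite sinB sinD; ring.
Qed.

Lemma sum_cos_eq0 (M m : nat) : (0 < m < M)%N ->
  \sum_(j < M) cos (j%:R * (m%:R * (2 * pi / M%:R))) = 0 :> R.
Proof.
move=> /andP[m0 mM].
have M0 : (0 : R) < M%:R by rewrite ltr0n (leq_ltn_trans _ mM).
have s0 : 0 < sin (m%:R * (2 * pi / M%:R) / 2) :> R.
  have e : m%:R * (2 * pi / M%:R) / 2 = (m%:R / M%:R) * pi :> R by field; lra.
  rewrite e; apply: sin_gt0_pi; apply/andP; split.
    by rewrite mulr_gt0 ?pi_gt0 // divr_gt0 // ltr0n.
  by rewrite -[ltRHS]mul1r ltr_pM2r ?pi_gt0 // ltr_pdivrMr // mul1r ltr_nat.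
apply: (mulIf (x := 2 * sin (m%:R * (2 * pi / M%:R) / 2))); first by lra.
rewrite sum_cos_mul_sin mul0r.
have -> : M%:R * (m%:R * (2 * pi / M%:R)) = pi *+ (2 * m) :> R.
  by rewrite -[RHS]mulr_natl natrM; field; lra.
by rewrite mulrnA [X in sin X + _]addrC (periodicn (@sinD2pi R)) sinN addNr.
Qed.


Definition root_of_unity (M : nat) (j : nat) : R[i] :=
  Complex (cos (j%:R * (2 * pi / M%:R))) (sin (j%:R * (2 * pi / M%:R))).

Lemma root_of_unityX M j k : root_of_unity M j ^+ k =
  Complex (cos (k%:R * (j%:R * (2 * pi / M%:R)))) (sin (k%:R * (j%:R * (2 * pi / M%:R)))).
Proof.
elim: k => [|k IH]; first by rewrite expr0 !mul0r cos0 sin0.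
set t := _ * (2 * pi / _) in IH *.
rewrite exprS IH -(natr1 k) mulrDl mul1r sinD cosD.
by apply/eqP; rewrite eq_complex /=; apply/andP; split; apply/eqP; ring.
Qed.

(** The summand is the real part of $z^k\overline{z^l}$, a cosine of $l-k$ times the angle. The
    bounds on [k] and [l] keep $l-k$ from being a nonzero multiple of [M]. *)
Lemma root_of_unity_orth (M k l : nat) : (k < M)%N -> (l < M)%N ->
  \sum_(j < M) (complex.Re (root_of_unity M j ^+ k) * complex.Re (root_of_unity M j ^+ l) +
                complex.Im (root_of_unity M j ^+ k) * complex.Im (root_of_unity M j ^+ l)) =
  if k == l then M%:R else 0.
Proof.
wlog kl : k l / (k <= l)%N => [hw kM lM|kM lM].
  have [kl|/ltnW lk] := leqP k l; first exact: hw.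
  rewrite eq_sym -(hw l k) //; apply: eq_bigr => j _.
  by rewrite [X in X + _]mulrC [X in _ + X]mulrC.
have [->|nkl] := eqVneq k l.
  have -> : M%:R = \sum_(j < M) 1 :> R by rewrite sumr_const card_ord.
  apply: eq_bigr => j _; rewrite root_of_unityX /=.
  by rewrite -!expr2 cos2Dsin2.
rewrite /= -[RHS](@sum_cos_eq0 M (l - k)); last first.
  by rewrite subn_gt0 ltn_neqAle nkl kl (leq_ltn_trans (leq_subr _ _)).
apply: eq_bigr => j _; rewrite !root_of_unityX /= natrB // -cosB -cosN; congr cos.
ring.
Qed.

Let dot (a b : H) := qre (qconj a * b).

Lemma dot_sum (M : nat) (c : 'I_M -> nat -> R) U V n :
  (size U <= n)%N -> (size V <= n)%N ->
  \sum_(j < M) dot (wsum (c j) U) (wsum (c j) V) =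
  \sum_(k < n) \sum_(l < n) (\sum_(j < M) c j k * c j l) * dot U`_k V`_l.
Proof.
move=> hU hV.
under eq_bigr => j _.
  rewrite (wsum_widen _ hU) (wsum_widen _ hV) /dot raddf_sum mulr_suml raddf_sum.
  under eq_bigr => k _ do rewrite mulr_sumr raddf_sum.
  over.
rewrite exchange_big; apply: eq_bigr => k _; rewrite exchange_big.
apply: eq_bigr => l _; rewrite mulr_suml; apply: eq_bigr => j _.
rewrite -[LHS]/(qre (qconj (c j k *: U`_k) * (c j l *: V`_l))).
by rewrite qconjZ -scalerAl -scalerAr !qreZ mulrA.
Qed.

Lemma parseval U V n :
  (size U <= n)%N -> (size V <= n)%N ->
  \sum_(j < n) (dot (reval (root_of_unity n j) U) (reval (root_of_unity n j) V) +
                dot (ieval (root_of_unity n j) U) (ieval (root_of_unity n j) V)) =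
  n%:R * \sum_(k < n) dot U`_k V`_k.
Proof.
move=> hU hV; rewrite big_split /= !(dot_sum _ hU hV) -big_split mulr_sumr /=.
apply: eq_bigr => k _; rewrite -big_split (bigD1 k) //= [X in _ + X]big1 ?addr0.
  by rewrite -mulrDl -big_split root_of_unity_orth // eqxx.
move=> l lk; rewrite -mulrDl -big_split root_of_unity_orth //.
by rewrite val_eqE eq_sym (negPf lk) mul0r.
Qed.

(** At each root of unity the values of [p], [q] and [W] satisfy [slice_pairing_ge0]; summing and
    applying [parseval] turns these inequalities into one on coefficients. The freedom in [W] is
    what later brings in the quotient. *)
Lemma coef_pairing_ge0 p q W n :
  (forall x, `|x| = 1 -> 0 <= qre (qconj (seval p x) * seval q x)) ->
  (size (rconj p * W)%R <= n)%N -> (size (rconj q * W)%R <= n)%N ->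
  0 <= \sum_(k < n) qre (qconj (rconj q * W)`_k * (rconj p * W)`_k).
Proof.
move=> pos hp hq; case: n hp hq => [|n] hp hq; first by rewrite big_ord0.
rewrite -(pmulr_rge0 _ (ltr0Sn R n)) -(parseval hq hp) sumr_ge0 // => j _.
rewrite !revalM !ievalM /reval /ieval !wsum_rconj -/(reval _ _).
apply: slice_pairing_ge0 => I hI; rewrite -!seval_slice //; apply: pos.
apply/eqP; rewrite -(eqrXn2 (n := 2)) // slice_norm // expr1n.
by rewrite /= cos2Dsin2.
Qed.

End RootsOfUnity.

(** * Truncated inverses of quaternionic polynomials *)

Section ApproximateInverse.
Variable R : realType.
Local Notation H := (quaternion R).
Implicit Types (p q r F : {poly H}) (a : H) (e : R).

(** The Wiener algebra norm: submultiplicative, unchanged by powers of ['X], and an upper bound for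
    every coefficient, all independently of the degree. *)
Definition l1norm p : R := \sum_(k < size p) `|p`_k|.

Lemma l1norm_widen p n : (size p <= n)%N -> l1norm p = \sum_(k < n) `|p`_k|.
Proof.
move=> le; rewrite /l1norm (big_ord_widen n (fun k => `|p`_k|)) //.
rewrite big_mkcond; apply: eq_bigr => k _; case: ltnP => // ?.
by rewrite nth_default // normr0.
Qed.

Lemma l1norm_ge0 p : 0 <= l1norm p.
Proof. by rewrite sumr_ge0. Qed.

Lemma l1normD p q : l1norm (p + q) <= l1norm p + l1norm q.
Proof.
pose n := maxn (size p) (size q).
rewrite (l1norm_widen (n := n)) ?size_polyD //.
rewrite (@l1norm_widen p n) ?leq_maxl // (@l1norm_widen q n) ?leq_maxr //.
by rewrite -big_split ler_sum // => k _; rewrite coefD ler_normD.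
Qed.

Lemma l1norm_mulC a p : l1norm (a%:P * p) = `|a| * l1norm p.
Proof.
rewrite (l1norm_widen (n := size p)); last first.
  rewrite (leq_trans (size_polyMleq _ _)) // (leq_trans (n := (1 + size p).-1)%N) //.
  by rewrite -!subn1 leq_sub2r // leq_add2r size_polyC leq_b1.
by rewrite mulr_sumr; apply: eq_bigr => k _; rewrite coefCM qnormM.
Qed.

Lemma l1norm_mulXC p a : l1norm (p * 'X + a%:P) = l1norm p + `|a|.
Proof.
rewrite (l1norm_widen (n := (size p).+1)); last first.
  rewrite (leq_trans (size_polyD _ _)) // geq_max size_polyC.
  by rewrite (leq_trans (size_polyMleq _ _)) ?size_polyX ?addn2 // (leq_trans (leq_b1 _)).
rewrite big_ord_recl coefD coefMX coefC add0r addrC; congr (_ + _).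
by apply: eq_bigr => k _; rewrite coefD coefMX coefC addr0.
Qed.

Lemma l1normC a : l1norm a%:P = `|a|.
Proof.
by rewrite (l1norm_widen (n := 1)) ?size_polyC ?leq_b1 // big_ord1 coefC.
Qed.

Lemma l1norm_mulX p : l1norm (p * 'X) = l1norm p.
Proof. by have := l1norm_mulXC p 0; rewrite normr0 !addr0. Qed.

Lemma l1norm_mulXn p n : l1norm (p * 'X^n) = l1norm p.
Proof. by elim: n => [|n IH]; rewrite ?expr0 ?mulr1 // exprSr mulrA l1norm_mulX. Qed.

Lemma l1normM p q : l1norm (p * q) <= l1norm p * l1norm q.
Proof.
elim/poly_ind: p => [|p a IH].
  by rewrite mul0r -polyC0 l1normC normr0 mul0r.
rewrite l1norm_mulXC mulrDl -mulrA -commr_polyX mulrA.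
rewrite (le_trans (l1normD _ _)) // l1norm_mulX l1norm_mulC mulrDl.
by rewrite lerD2r.
Qed.

Lemma coef_l1norm p k : `|p`_k| <= l1norm p.
Proof.
have [kp|pk] := ltnP k (size p); last by rewrite nth_default // normr0 l1norm_ge0.
by rewrite /l1norm (bigD1 (Ordinal kp)) //= lerDl sumr_ge0.
Qed.

(* A substitute for "the inverse power series of [p] is summable" that stays within
   polynomials: truncated inverses with bounded coefficients, whose error is small
   and sits in high degrees only. *)
Definition approx_invertible p := exists2 C : R, 0 <= C &
  forall e, 0 < e -> exists M0, forall M, (M0 <= M)%N ->
  exists c r, [/\ p * c = 1 + r * 'X^M, l1norm c <= C & l1norm r <= e].

(** If $pc=1+rX^M$ and $qd=1+sX^M$, then $(pq)(dc)=1+(r+psc)X^M$. *)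
Lemma approx_invertibleM p q :
  approx_invertible p -> approx_invertible q -> approx_invertible (p * q).
Proof.
move=> [C C0 hp] [D D0 hq]; exists (D * C); first exact: mulr_ge0.
move=> e e0.
(* Chosen so that an error [s] of norm at most $e/(2B)$ leaves [p * s * c] with norm at most $e/2$;
   this relies on [C] being independent of the precision. The summand 1 makes [B] positive. *)
pose B := l1norm p * C + 1.
have B0 : 0 < B by rewrite ltr_wpDl // mulr_ge0 // l1norm_ge0.
have [M1 h1] := hp (e / 2) (divr_gt0 e0 (ltr0Sn _ _)).
have [M2 h2] := hq (e / 2 / B) (divr_gt0 (divr_gt0 e0 (ltr0Sn _ _)) B0).
exists (maxn M1 M2) => M; rewrite geq_max => /andP[/h1[c [r [pc nc nr]]] /h2[d [s [qd nd ns]]]].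
exists (d * c), (r + p * s * c); split.
- rewrite mulrA -(mulrA p) qd mulrDr mulr1 mulrDl pc mulrDl addrA.
  by congr (_ + _); rewrite -!mulrA (commr_polyXn c M).
- by rewrite (le_trans (l1normM _ _)) // ler_pM ?l1norm_ge0.
- rewrite (le_trans (l1normD _ _)) // [leRHS]splitr lerD //.
  rewrite (le_trans (l1normM _ _)) //.
  rewrite (@le_trans _ _ (l1norm p * (e / 2 / B) * C)) //.
    rewrite ler_pM ?l1norm_ge0 // (le_trans (l1normM _ _)) //.
    by rewrite ler_wpM2l ?l1norm_ge0.
  rewrite (_ : _ * C = (e / 2) * ((l1norm p * C) / B)); last by field; lra.
  rewrite -[leRHS]mulr1 ler_wpM2l //; first by lra.
  by rewrite ler_pdivrMr // mul1r /B lerDl.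
Qed.

Lemma approx_invertibleC a : a != 0 -> approx_invertible a%:P.
Proof.
move=> a0; exists `|a^-1| => // e e0; exists 0%N => M _; exists (a^-1)%:P, 0.
split; last by rewrite -polyC0 l1normC normr0 ltW.
  by rewrite -polyCM divrr // mul0r addr0.
by rewrite l1normC.
Qed.

Lemma l1norm_sum n (F : nat -> {poly H}) :
  l1norm (\sum_(i < n) F i) <= \sum_(i < n) l1norm (F i).
Proof.
elim: n => [|n IH]; first by rewrite !big_ord0 -polyC0 l1normC normr0.
by rewrite !big_ord_recr /= (le_trans (l1normD _ _)) // lerD2r.
Qed.

Lemma sum_expr_le (x : R) n : 0 <= x < 1 -> \sum_(i < n) x ^+ i <= (1 - x)^-1.
Proof.
move=> /andP[x0 x1]; have x1' : 0 < 1 - x by rewrite subr_gt0.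
rewrite -(ler_pM2r x1') mulVf ?gt_eqF // mulrC -subr_ge0.
have -> : 1 - (1 - x) * \sum_(i < n) x ^+ i = x ^+ n.
  by rewrite -[1 - x]opprB mulNr opprK -subrX1 addrC subrK.
exact: exprn_ge0.
Qed.

Lemma expr_small (x e : R) : 0 <= x < 1 -> 0 < e ->
  exists N, forall n, (N <= n)%N -> x ^+ n <= e.
Proof.
move=> /andP[x0 x1] e0.
have : (fun n => x ^+ n) @ \oo --> (0 : R) by apply: cvg_expr; rewrite ger0_norm.
move=> /cvgrPdist_le /(_ e e0) [N _ hN]; exists N => n Nn.
by have := hN n Nn; rewrite /= sub0r normrN ger0_norm ?exprn_ge0.
Qed.

(** Truncated geometric series: minus the first [M] powers of $aX$ invert $aX-1$ up to $-a^MX^M$,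
    which is small since $|a|<1$. *)
Lemma approx_invertible_lin a : `|a| < 1 -> approx_invertible (a%:P * 'X - 1).
Proof.
move=> a1; exists ((1 - `|a|)^-1); first by rewrite invr_ge0 subr_ge0 ltW.
have a01 : 0 <= `|a| < 1 by rewrite normr_ge0.
move=> e e0; have [N hN] := expr_small a01 e0.
have aXE i : (a%:P * 'X) ^+ i = (a ^+ i)%:P * 'X^i.
  by rewrite exprMn_comm ?polyC_exp //; exact: commr_polyX.
exists N => M NM; exists (- \sum_(i < M) (a%:P * 'X) ^+ i), (- (a ^+ M)%:P); split.
- by rewrite mulrN -subrX1 opprB aXE mulNr.
- rewrite -mulN1r -polyCN l1norm_mulC normrN qnorm1 mul1r.
  rewrite (le_trans (l1norm_sum _ _)) //.
  rewrite (le_trans _ (sum_expr_le M a01)) // ler_sum // => i _.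
  by rewrite aXE l1norm_mulXn l1normC qnormX.
- by rewrite -polyCN l1normC normrN qnormX hN.
Qed.

Lemma approx_invertible_XsubC a : 1 < `|a| -> approx_invertible ('X - a%:P).
Proof.
move=> a1; have a0 : a != 0 by rewrite -normr_gt0 (lt_trans _ a1).
have -> : 'X - a%:P = a%:P * ((a^-1)%:P * 'X - 1).
  by rewrite mulrBr mulrA -polyCM divrr // mul1r mulr1.
apply: approx_invertibleM; first exact: approx_invertibleC.
by apply: approx_invertible_lin; rewrite qnormV invf_lt1 // (lt_trans _ a1).
Qed.

(** A ring embedding of the complex numbers as one slice; it carries the factorization of a complex
    polynomial into linear factors over to [{poly H}]. *)
Definition cquat (z : R[i]) : H := slice_pt (iunit R) (complex.Re z) (complex.Im z).

Lemma cquat0 : cquat 0 = 0.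
Proof. by apply/quaternionP; split=> /=; ring. Qed.

Lemma cquatD : {morph cquat : z w / z + w}.
Proof. by move=> [x y] [s t]; apply/quaternionP; split=> /=; ring. Qed.

Lemma cquat_monoid : monoid_morphism cquat.
Proof.
split; first by apply/quaternionP; split=> /=; ring.
by move=> [x y] [s t]; rewrite /cquat slice_ptM //; exact: imag_iunit.
Qed.

HB.instance Definition _ := GRing.isNmodMorphism.Build R[i] H cquat (conj cquat0 cquatD).
HB.instance Definition _ := GRing.isMonoidMorphism.Build R[i] H cquat cquat_monoid.

Lemma approx_invertible_complex (P : {poly R[i]}) : P != 0 ->
  (forall z, root P z -> 1 < `|cquat z|) -> approx_invertible (map_poly cquat P).
Proof.
move=> P0 rootP; have [s defP] := closed_field_poly_normal P.
have l0 : lead_coef P != 0 by rewrite lead_coef_eq0.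
have {rootP} rs z : z \in s -> 1 < `|cquat z|.
  by move=> zs; apply: rootP; rewrite defP rootZ // root_prod_XsubC.
rewrite defP -mul_polyC rmorphM /= map_polyC; apply: approx_invertibleM.
  by apply: approx_invertibleC; rewrite fmorph_eq0.
elim: s {defP} rs => [|z s IH] rs.
  by rewrite big_nil rmorph1 -polyC1; apply: approx_invertibleC; rewrite oner_eq0.
rewrite big_cons rmorphM /= rmorphB /= map_polyX map_polyC.
apply: approx_invertibleM; last by apply: IH => w ws; apply: rs; rewrite inE ws orbT.
by apply: approx_invertible_XsubC; apply: rs; rewrite inE eqxx.
Qed.

Lemma rconjM p q : rconj (p * q) = rconj q * rconj p.
Proof.
apply/polyP => k; rewrite coef_rconj coefM coefMr raddf_sum /=.
by apply: eq_bigr => j _; rewrite !coef_rconj -qconjM.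
Qed.

Lemma rconjK p : rconj (rconj p) = p.
Proof. by apply/polyP => k; rewrite !coef_rconj qconjK. Qed.

(** For $b\ne0$ the hypotheses say that $ab^{-1}$ has norm 1 and real part 0, so it is an imaginary
    unit, and its opposite solves the equation. *)
Lemma slice_zero (a b : H) : `|a| = `|b| -> qre (qconj a * b) = 0 ->
  exists2 I, qimag_units I & a + I * b = 0.
Proof.
move=> ab orth; have [b0|b0] := eqVneq b 0.
  exists (iunit R); first exact: imag_iunit.
  by rewrite b0 mulr0 addr0; apply/eqP; rewrite -normr_eq0 ab b0 normr0.
exists (- (a * b^-1)); last by rewrite mulNr -mulrA mulVr // mulr1 subrr.
apply: imag_opp; apply/imag_unitP; split; last first.
  by rewrite qnormM qnormV ab divff // normr_eq0.
rewrite -[b^-1]/((qsqnorm b)^-1 *: qconj b) -scalerAr qreZ.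
have -> : qre (a * qconj b) = qre (qconj a * b) by rewrite /=; ring.
by rewrite orth mulr0.
Qed.

(* [rconj p * p] has real coefficients, hence splits over the complex numbers, and a
   complex zero of it produces a zero of [p] on the corresponding sphere. *)
Lemma approx_invertible_rconj p :
  (forall x, `|x| <= 1 -> seval p x != 0) -> approx_invertible (rconj p).
Proof.
move=> nz; pose Q := rconj p * p.
(* [Q] is its own regular conjugate, so its coefficients are real. *)
have QE k : Q`_k = (qre Q`_k)%:A.
  have : rconj Q = Q by rewrite /Q rconjM rconjK.
  move=> /(congr1 (fun p : {poly H} => p`_k)); rewrite coef_rconj.
  case: (Q`_k) => x y z t /quaternionP[/= _ e1 e2 e3].
  by apply/quaternionP; split=> /=; lra.
pose P : {poly R[i]} := map_poly (real_complex R) (map_poly (@qre R) Q).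
have coefP k : P`_k = Complex (qre Q`_k) 0 by rewrite coef_map /= coef_map.
have defQ : Q = map_poly cquat P.
  apply/polyP => k; rewrite coef_map coefP [LHS]QE.
  by apply/quaternionP; split=> /=; ring.
have p0 : seval p 0 = p`_0.
  have [s0|s0] := posnP (size p).
    by rewrite /seval s0 big_ord0 nth_default // s0.
  rewrite /seval; case: (size p) s0 => // n _; rewrite big_ord_recl big1 ?addr0.
    by rewrite expr0 mul1r.
  by move=> i _; rewrite exprS mul0r mul0r.
have P0 : P != 0.
  apply/eqP => /(congr1 (fun p : {poly R[i]} => p`_0)).
  rewrite coefP coef0 /Q coef0M coef_rconj qre_mul_conj => -[] /eqP.
  rewrite mulf_eq0 orbb normr_eq0 -p0 => e.
  by have := nz 0; rewrite e normr0 ler01 => /(_ isT).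
have evP z : P.[z] = Complex (qre (reval z Q)) (qre (ieval z Q)).
  rewrite (@horner_coef_wide _ (size Q)); last first.
    by rewrite (leq_trans (size_poly _ _)) // (leq_trans (size_poly _ _)).
  rewrite /reval /ieval /wsum !raddf_sum.
  elim/big_ind3: _ => // [? ? ? ? ? ? -> -> //|k _].
  rewrite coefP; case: (z ^+ k) => x y.
  apply/eqP; rewrite eq_complex /=; apply/andP; split; apply/eqP; ring.
have [C C0 hC] : approx_invertible (map_poly cquat P).
  apply: approx_invertible_complex => // z /eqP.
  rewrite evP /Q revalM ievalM /reval /ieval !wsum_rconj -/(reval _ _) -/(ieval _ _).
  set a := reval z p; set b := ieval z p => e.
  (* [P.[z]] equals $|a|^2-|b|^2+2i\,\mathrm{Re}(\bar ab)$; its vanishing yields the two hypotheses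
     of [slice_zero]. *)
  have e1 : qre (qconj a * a - qconj b * b) = 0 := congr1 (@complex.Re R) e.
  have e2 : qre (qconj a * b + qconj b * a) = 0 := congr1 (@complex.Im R) e.
  rewrite ltNge; apply/negP => z1.
  have [||I hI abI] := @slice_zero a b.
  - apply/eqP; rewrite -(eqrXn2 (n := 2)) // -!qre_mul_conj.
    by rewrite -subr_eq0; apply/eqP; rewrite -[RHS]e1 /=; ring.
  - move: e2; have -> : qre (qconj a * b + qconj b * a) = 2 * qre (qconj a * b).
      by rewrite /=; ring.
    by move/eqP; rewrite mulf_eq0 pnatr_eq0 /= => /eqP.
  suff /nz : `|slice_pt I (complex.Re z) (complex.Im z)| <= 1 by rewrite seval_slice // abI eqxx.
  rewrite -(@expr_le1 _ 2) // slice_norm //.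
  by rewrite -(slice_norm _ _ (imag_iunit R)) expr_le1.
rewrite -defQ in hC.
exists (l1norm p * C); first by rewrite mulr_ge0 ?l1norm_ge0.
move=> e /hC [M0 hM]; exists M0 => M /hM [c [r [Qc nc nr]]].
(* As [rconj p * (p * c) = Q * c], an approximate inverse of [Q] provides one of [rconj p]. *)
exists (p * c), r; split=> //; first by rewrite mulrA.
by rewrite (le_trans (l1normM _ _)) // ler_wpM2l ?l1norm_ge0.
Qed.

End ApproximateInverse.

(** * The inequality for polynomials *)

Section PolynomialCase.
Variable R : realType.
Local Notation H := (quaternion R).
Implicit Types (p q : {poly H}) (e : R).

(** Half the quadratic form of the Hermitian Toeplitz matrix with diagonal 2 and subdiagonals [a],
    [b]: the pairing of the vector with its image under the lower triangular Toeplitz matrix of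
    $1,a,b$. *)
Definition pair3 (a y0 y1 y2 b : H) : R :=
  qre (qconj y0 * y0) + qre (qconj (a * y0 + y1) * y1) +
  qre (qconj (b * y0 + a * y1 + y2) * y2).

(* Test the coefficient pairing on [W = c * Y], [c] an approximate inverse of
   [rconj p]: then [rconj p * W] is nearly [Y], while [rconj (p * 'X)^`() * W] is nearly
   the conjugate of the quotient series [p_1, p_2, ...] of the header applied to [Y]. *)
Lemma toeplitz_ge0 p (y0 y1 y2 : H) : p`_0 = 1 ->
  (forall x, `|x| <= 1 -> 0 < qre (qconj (seval p x) * seval (p * 'X)^`() x)) ->
  0 <= pair3 (qconj p`_1) y0 y1 y2 (2 *: qconj p`_2 - qconj p`_1 ^+ 2).
Proof.
move=> p0 pos; set T := pair3 _ _ _ _ _.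
pose q := (p * 'X)^`().
have coefq k : q`_k = k.+1%:R *: p`_k by rewrite coef_deriv coefMX /= scaler_nat.
have nz x : `|x| <= 1 -> seval p x != 0.
  by move=> /pos; apply: contraTneq => ->; rewrite qconj0 mul0r ltxx.
have [C C0 hC] := approx_invertible_rconj nz.
pose Y : {poly H} := Poly [:: y0; y1; y2].
have sY : (size Y <= 3)%N by exact: size_Poly.
pose B := l1norm (rconj q) * (C * l1norm Y) * l1norm Y.
have B0 : 0 <= B by rewrite !mulr_ge0 ?l1norm_ge0.
(* [B] does not depend on [e]. A negative [T] is refuted at $e=-T/(B+1)$, where the right-hand side
   is $T/(B+1)$. *)
suff TB e : 0 < e -> 0 <= T + B * e.
  clearbody T B; rewrite leNgt; apply/negP => T0.
  have B1 : 0 < B + 1 by rewrite ltr_wpDl.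
  have T1 : 0 < - T / (B + 1) by rewrite divr_gt0 // oppr_gt0.
  have := TB _ T1.
  have -> : T + B * (- T / (B + 1)) = T / (B + 1) by field; rewrite gt_eqF.
  by rewrite pmulr_lge0 ?invr_gt0 // leNgt T0.
move=> e0; have [M0 hM] := hC e e0.
(* Order at least 3 keeps the error [r * 'X^M] away from the coefficients 0, 1, 2. *)
pose M := maxn M0 3.
have [c [r [pc nc nr]]] := hM M (leq_maxl _ _).
have M3 : (3 <= M)%N by exact: leq_maxr.
have low k : (k < 3)%N -> (rconj p * c)`_k = (k == 0)%:R.
  move=> k3; rewrite pc coefD coef1 coefMXn (leq_trans k3 M3) addr0.
  by case: k k3 => // -[|[]].
have c0 : c`_0 = 1 by have := low 0 isT; rewrite coef0M coef_rconj p0 qconj1 mul1r.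
have c1 : c`_1 = - qconj p`_1.
  have := low 1 isT; rewrite coefM !big_ord_recl big_ord0 /= !coef_rconj.
  by rewrite p0 qconj1 mul1r c0 mulr1 addr0 => /eqP; rewrite addr_eq0 => /eqP.
have c2 : c`_2 = qconj p`_1 ^+ 2 - qconj p`_2.
  have := low 2 isT; rewrite coefM !big_ord_recl big_ord0 /= !coef_rconj.
  rewrite p0 qconj1 mul1r c0 mulr1 addr0 c1 mulrN -expr2 => /eqP.
  by rewrite addr_eq0 opprD opprK => /eqP.
pose g := rconj q * c.
have g0 : g`_0 = 1 by rewrite coef0M coef_rconj coefq scale1r p0 qconj1 c0 mulr1.
have g1 : g`_1 = qconj p`_1.
  rewrite coefM !big_ord_recl big_ord0 /= !coef_rconj !coefq scale1r p0 qconj1.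
  rewrite mul1r c0 mulr1 c1 qconjZ addr0 scaler_nat mulr2n; exact: addKr.
have g2 : g`_2 = 2 *: qconj p`_2 - qconj p`_1 ^+ 2.
  rewrite coefM !big_ord_recl big_ord0 /= !coef_rconj !coefq scale1r p0 qconj1.
  rewrite mul1r c0 mulr1 c1 c2 !qconjZ addr0 -scalerAl mulrN.
  rewrite /bump /= !addn0 !add1n; by apply/quaternionP; split=> /=; ring.
pose U := rconj q * (c * Y); pose V := rconj p * (c * Y).
have gU : U = g * Y by rewrite /U mulrA.
have VE : V = Y + (r * Y) * 'X^M.
  by rewrite /V mulrA pc mulrDl mul1r -!mulrA (commr_polyXn Y M).
pose n := maxn 3 (maxn (size V) (size U)).
have n3 : (3 <= n)%N by exact: leq_maxl.
have pos1 x : `|x| = 1 -> 0 <= qre (qconj (seval p x) * seval q x).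
  by move=> hx; apply/ltW/pos; rewrite hx.
have hV : (size V <= n)%N by rewrite (leq_trans (leq_maxl _ _) (leq_maxr _ _)).
have hU : (size U <= n)%N by rewrite (leq_trans (leq_maxr _ _) (leq_maxr _ _)).
apply: le_trans (coef_pairing_ge0 pos1 hV hU) _.
rewrite -/U -/V.
have -> : \sum_(k < n) qre (qconj U`_k * V`_k) =
  \sum_(k < n) qre (qconj U`_k * Y`_k) + \sum_(k < n) qre (qconj U`_k * (r * Y * 'X^M)`_k).
  by rewrite -big_split; apply: eq_bigr => k _; rewrite VE coefD mulrDr raddfD.
apply: lerD.
  have U0 : U`_0 = y0 by rewrite gU coef0M g0 mul1r coef_Poly.
  have U1 : U`_1 = qconj p`_1 * y0 + y1.
    by rewrite gU coefM !big_ord_recl big_ord0 addr0 /= g0 g1 mul1r !coef_Poly addrC.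
  have U2 : U`_2 = (2 *: qconj p`_2 - qconj p`_1 ^+ 2) * y0 + qconj p`_1 * y1 + y2.
    rewrite gU coefM !big_ord_recl big_ord0 addr0 /= g0 g1 g2 mul1r !coef_Poly.
    by rewrite addrC [X in X + _]addrC.
  have -> : \sum_(k < n) qre (qconj U`_k * Y`_k) = \sum_(k < 3) qre (qconj U`_k * Y`_k).
    rewrite (big_ord_widen n (fun k => qre (qconj U`_k * Y`_k)) n3) [RHS]big_mkcond.
    apply: eq_bigr => k _; case: ltnP => // k3.
    by rewrite [Y`_k]nth_default ?mulr0 ?(leq_trans sY).
  rewrite -(big_mkord xpredT (fun k => qre (qconj U`_k * Y`_k))) !big_nat_recl // big_geq //.
  by rewrite U0 U1 U2 !coef_Poly addr0 addrA.
(* What is left pairs [U] with the high-order error alone; its size is controlled by [l1norm] and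
   the bound on [r], whatever the degrees are. *)
apply: (@le_trans _ _ (l1norm U * l1norm (r * Y * 'X^M))).
  rewrite (l1norm_widen hU).
  rewrite mulr_suml ler_sum // => k _; rewrite (le_trans (qre_le _)) // qnormM qnorm_conj.
  by rewrite ler_wpM2l // coef_l1norm.
rewrite l1norm_mulXn /B -[leRHS]mulrA.
have -> : l1norm Y * e = e * l1norm Y by rewrite mulrC.
rewrite ler_pM ?l1norm_ge0 //.
  rewrite (le_trans (l1normM _ _)) // ler_wpM2l ?l1norm_ge0 //.
  by rewrite (le_trans (l1normM _ _)) // ler_wpM2r ?l1norm_ge0.
by rewrite (le_trans (l1normM _ _)) // ler_wpM2r ?l1norm_ge0.
Qed.

(* Minimising [pair3] over [y1] takes the Schur complement of the Toeplitz matrix. *)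
Lemma pair3_schur (a b : H) : (forall y0 y1 y2, 0 <= pair3 a y0 y1 y2 b) ->
  `|b - 2^-1 *: a ^+ 2| <= 2 - `|a| ^+ 2 / 2.
Proof.
move=> pos; set k := b - _.
(* For [y0 = 1] the part of the form depending on [y1] is $|y_1|^2+\mathrm{Re}(\bar y_1(a+\bar
   ay_2))$, minimal at $y_1=-\frac12(a+\bar ay_2)$. *)
have main y2 : 0 <= (1 - `|a| ^+ 2 / 4) * (1 + `|y2| ^+ 2) + qre (qconj k * y2).
  have := pos 1 (- 2^-1 *: (a + qconj a * y2)) y2.
  by congr (0 <= _); rewrite !qnorm_sqr /pair3 /k /qsqnorm /=; field.
have [k0|k0] := eqVneq k 0.
  by have := main 0; rewrite k0 !normr0 mulr0; lra.
have n0 : 0 < `|k| by rewrite normr_gt0.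
(* The unit vector opposite to [k] turns the last term of [main] into $-|k|$ and the factor
   $1+|y_2|^2$ into 2. *)
have := main (- (`|k|^-1 *: k)).
rewrite normrN normrZ normfV normr_id mulVf ?gt_eqF // expr1n.
have -> : qre (qconj k * - (`|k|^-1 *: k)) = - `|k|.
  rewrite mulrN -scalerAr -[LHS]/(- (`|k|^-1 * qre (qconj k * k))) qre_mul_conj.
  by field; lra.
lra.
Qed.

(** The value $\frac34$ comes from $p_2-\frac12p_1^2=2(a_3-\frac34a_2^2)$. With $A=|a_2|^2$ the
    triangle inequality gives $(1-\frac A4)+\frac A4|4\lambda-3|$, a convex combination of 1 and
    $|4\lambda-3|$, because the bound $1-\frac A4$ on a norm forces $A\le4$; hence the maximum. *)
Lemma fekete_szego_poly p (lam : H) : p`_0 = 1 ->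
  (forall x, `|x| <= 1 -> 0 < qre (qconj (seval p x) * seval (p * 'X)^`() x)) ->
  `|p`_2 - lam * p`_1 ^+ 2| <= Num.max 1 `|4 * lam - 3|.
Proof.
move=> p0 pos.
have := pair3_schur (fun y0 y1 y2 => toeplitz_ge0 y0 y1 y2 p0 pos).
set a := p`_1; set b := p`_2; rewrite qnorm_conj => h.
have {}h : `|b - (3/4) *: a ^+ 2| <= 1 - `|a| ^+ 2 / 4.
  have e : 2 *: qconj (b - (3/4) *: a ^+ 2) = 2 *: qconj b - qconj a ^+ 2 - 2^-1 *: qconj a ^+ 2.
    by apply/quaternionP; split=> /=; field.
  move: h; rewrite -e normrZ qnorm_conj ger0_norm; lra.
have -> : b - lam * a ^+ 2 = (b - (3/4) *: a ^+ 2) - 4^-1 *: ((4 * lam - 3) * a ^+ 2).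
  rewrite !mulr_natl.
  by apply/quaternionP; split=> /=; field.
apply: le_trans (ler_normB _ _) _.
rewrite normrZ qnormM qnormX ger0_norm; last by lra.
set L := `|4 * lam - 3|; set A := `|a| ^+ 2 in h *.
have A0 : 0 <= A by exact: sqr_ge0.
have n0 : 0 <= `|b - (3/4) *: a ^+ 2| by [].
have L0 : 0 <= L by exact: normr_ge0.
rewrite le_max; case: (lerP L 1) => hL.
  by apply/orP; left; nra.
by apply/orP; right; nra.
Qed.

End PolynomialCase.

(** * Quaternionic power series *)

Section PowerSeries.
Variable R : realType.
Local Notation H := (quaternion R).
Implicit Types (a : nat -> H) (f g : H -> H) (q w : H) (r x : R).

Lemma seq_cvgP (V : normedModType R) (u : nat -> V) (l : V) :
  u @ \oo --> l <->
  (forall e, 0 < e -> exists N, forall n, (N <= n)%N -> `|l - u n| <= e).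
Proof.
split=> [/cvgrPdist_le h e /h[N _ hN]|h]; first by exists N.
by apply/cvgrPdist_le => e /h[N hN]; exists N.
Qed.

Lemma lim_dist_le (V : normedModType R) (u : nat -> V) (l c : V) B N :
  u @ \oo --> l -> (forall n, (N <= n)%N -> `|u n - c| <= B) -> `|l - c| <= B.
Proof.
move=> /seq_cvgP h uB; apply/ler_addgt0Pl => e /h[M hM].
have := hM _ (leq_maxl M N); have := uB _ (leq_maxr M N).
move: (maxn M N) => n h1 h2.
have -> : l - c = (l - u n) + (u n - c) by rewrite addrA subrK.
by rewrite (le_trans (ler_normD _ _)) // lerD.
Qed.

Lemma lim_norm_le (V : normedModType R) (u : nat -> V) (l : V) B :
  u @ \oo --> l -> (forall n, `|u n| <= B) -> `|l| <= B.
Proof.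
move=> h uB; rewrite -[l]subr0; apply: (@lim_dist_le _ _ _ _ _ 0 h) => n _.
by rewrite subr0.
Qed.

Lemma cvg_qmull q (u : nat -> H) (l : H) :
  u @ \oo --> l -> (fun n => q * u n) @ \oo --> q * l.
Proof.
move=> /seq_cvgP h; apply/seq_cvgP => e e0.
have q1 : 0 < `|q| + 1 by rewrite ltr_wpDl.
have [N hN] := h (e / (`|q| + 1)) (divr_gt0 e0 q1); exists N => n /hN.
rewrite -mulrBr qnormM ler_pdivlMr // => ?; apply: le_trans _ (_ : _ <= e); last by eassumption.
by rewrite mulrC ler_wpM2l // lerDl.
Qed.

Lemma cvg_qmulr q (u : nat -> H) (l : H) :
  u @ \oo --> l -> (fun n => u n * q) @ \oo --> l * q.
Proof.
move=> /seq_cvgP h; apply/seq_cvgP => e e0.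
have q1 : 0 < `|q| + 1 by rewrite ltr_wpDl.
have [N hN] := h (e / (`|q| + 1)) (divr_gt0 e0 q1); exists N => n /hN.
rewrite -mulrBl qnormM ler_pdivlMr // => ?; apply: le_trans _ (_ : _ <= e); last by eassumption.
by rewrite ler_wpM2l // lerDl.
Qed.

Lemma cvgn_unique (V : normedModType R) (u : nat -> V) (l m : V) :
  u @ \oo --> l -> u @ \oo --> m -> l = m.
Proof. exact: (cvg_unique (@norm_hausdorff _ _)). Qed.

(** Radius of convergence at least 1, in Abel's form: a bound for each radius, which passes easily
    to shifted and differentiated series. *)
Definition subgeometric a := forall r, 0 < r -> r < 1 ->
  exists2 K, 0 <= K & forall n, `|a n| * r ^+ n <= K.

Lemma has_qseries_subgeometric f a : has_qseries f a -> subgeometric a.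
Proof.
move=> fa r r0 r1; have : qball (r%:A : H) by rewrite /qball /= qnormA gtr0_norm.
move=> /fa /cvgP /cvg_series_cvg_0 /seq_cvgP /(_ 1 ltr01) [N hN].
have {}hN n : (N <= n)%N -> `|a n| * r ^+ n <= 1.
  by move=> /hN; rewrite sub0r normrN qnormM qnormX qnormA gtr0_norm // mulrC.
exists (1 + \sum_(k < N) `|a k| * r ^+ k).
  by rewrite addr_ge0 // sumr_ge0 // => k _; rewrite mulr_ge0 // exprn_ge0 // ltW.
move=> n; have [nN|/hN h] := ltnP n N; last first.
  rewrite (le_trans h) // lerDl sumr_ge0 // => k _.
  by rewrite mulr_ge0 // exprn_ge0 // ltW.
rewrite (bigD1 (Ordinal nN)) //= addrCA lerDl addr_ge0 // sumr_ge0 // => k _.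
by rewrite mulr_ge0 // exprn_ge0 // ltW.
Qed.

(** An intermediate radius $t$ absorbs the factor: for $x=r/t<1$ one has $(n+1)x^n\le\sum_{i\le
    n}x^i\le(1-x)^{-1}$. *)
Lemma subgeometric_natmul a :
  subgeometric a -> subgeometric (fun n => n.+1%:R *: a n).
Proof.
move=> ha r r0 r1; pose t := (1 + r) / 2.
have t0 : 0 < t by rewrite /t; lra.
have t1 : t < 1 by rewrite /t; lra.
have [K K0 hK] := ha t t0 t1.
pose x := r / t.
have x01 : 0 <= x < 1.
  rewrite /x divr_ge0 ?(ltW r0) ?(ltW t0) //= ltr_pdivrMr // mul1r /t; lra.
have [x0 x1] := andP x01.
exists (K * (1 - x)^-1); first by rewrite mulr_ge0 // invr_ge0 subr_ge0 ltW.
move=> n; rewrite normrZ normr_nat.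
have -> : n.+1%:R * `|a n| * r ^+ n = (`|a n| * t ^+ n) * (n.+1%:R * x ^+ n).
  rewrite [x ^+ n]expr_div_n; have : t ^+ n != 0 by rewrite expf_neq0 // gt_eqF.
  by move: (t ^+ n) (r ^+ n) `|a n| n.+1%:R => T S A m T0; field.
rewrite ler_pM ?mulr_ge0 ?exprn_ge0 // ?(ltW t0) //.
apply: le_trans _ (sum_expr_le n.+1 x01).
rewrite mulr_natl -[X in _ *+ X]card_ord -sumr_const ler_sum // => i _.
by rewrite ler_wiXn2l ?(ltW x1) // -ltnS.
Qed.

Lemma subgeometric_shift a : subgeometric a -> subgeometric (fun n => a n.+1).
Proof.
move=> ha r r0 r1; have [K K0 hK] := ha r r0 r1; exists (K / r).
  by rewrite divr_ge0 // ltW.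
by move=> n; rewrite ler_pdivlMr // -mulrA -exprSr.
Qed.

Lemma subgeometric_bound a r : subgeometric a -> 0 <= r -> r < 1 ->
  exists K x, [/\ 0 <= K, 0 <= x < 1 & forall n, `|a n| * r ^+ n <= K * x ^+ n].
Proof.
move=> ha r0 r1; pose t := (1 + r) / 2.
have t0 : 0 < t by rewrite /t; lra.
have t1 : t < 1 by rewrite /t; lra.
have [K K0 hK] := ha t t0 t1; exists K, (r / t); split=> //.
  rewrite divr_ge0 ?(ltW t0) //= ltr_pdivrMr // mul1r /t; lra.
move=> n; rewrite -(@ler_pM2r _ (t ^+ n)) ?exprn_gt0 //.
rewrite -[leRHS]mulrA -[in leRHS]exprMn divfK ?gt_eqF // [leLHS]mulrAC.
by rewrite ler_wpM2r ?exprn_ge0.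
Qed.

Lemma subgeometric_sum_le a r : subgeometric a -> 0 <= r -> r < 1 ->
  exists2 K, 0 <= K & forall N, \sum_(n < N) `|a n| * r ^+ n <= K.
Proof.
move=> ha r0 r1; have [K [x [K0 x01 hK]]] := subgeometric_bound ha r0 r1.
have [x0 x1] := andP x01.
exists (K * (1 - x)^-1); first by rewrite mulr_ge0 // invr_ge0 subr_ge0 ltW.
move=> N; apply: (@le_trans _ _ (\sum_(n < N) K * x ^+ n)).
  by rewrite ler_sum.
by rewrite -mulr_sumr ler_wpM2l // sum_expr_le.
Qed.

(** Convergence is reduced to the four real coordinate series, each dominated by the geometric one,
    and the limits are recombined linearly. *)
Lemma cvg_series_geom (u : nat -> H) K x : 0 <= x < 1 ->
  (forall n, `|u n| <= K * x ^+ n) -> exists l : H, series u @ \oo --> l.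
Proof.
move=> /andP[x0 x1] uK.
have real (v : nat -> R) : (forall n, `|v n| <= `|u n|) -> exists l : R, series v @ \oo --> l.
  move=> vu; suff /cvg_ex : cvgn (series v) by [].
  apply: normed_cvg; apply: (@series_le_cvg _ _ (geometric K x)) => [n|n|n|].
  - exact: normr_ge0.
  - exact: le_trans (normr_ge0 _) (uK n).
  - exact: le_trans (vu n) (uK n).
  - by apply: is_cvg_geometric_series; rewrite ger0_norm.
have sq (c : H -> R) : (forall q, (c q) ^+ 2 <= qsqnorm q) -> forall q, `|c q| <= `|q|.
  move=> h q; rewrite -(ler_pXn2r (n := 2)) ?nnegrE // real_normK ?num_real //.
  by rewrite qnorm_sqr.
have [l0 h0] := real (fun n => qre (u n)) (fun n => qre_norm (u n)).
have [l1 h1] : exists l : R, series (fun n => qi (u n)) @ \oo --> l.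
  apply: real => n; apply: (sq (@qi R)) => q; rewrite /qsqnorm; nra.
have [l2 h2] : exists l : R, series (fun n => qj (u n)) @ \oo --> l.
  apply: real => n; apply: (sq (@qj R)) => q; rewrite /qsqnorm; nra.
have [l3 h3] : exists l : R, series (fun n => qk (u n)) @ \oo --> l.
  apply: real => n; apply: (sq (@qk R)) => q; rewrite /qsqnorm; nra.
pose e0 : H := Quaternion 1 0 0 0; pose e1 : H := Quaternion 0 1 0 0.
pose e2 : H := Quaternion 0 0 1 0; pose e3 : H := Quaternion 0 0 0 1.
exists (l0 *: e0 + l1 *: e1 + l2 *: e2 + l3 *: e3).
have -> : series u = (fun n => series (fun n => qre (u n)) n *: e0 + series (fun n =>
  qi (u n)) n *: e1 +
   series (fun n => qj (u n)) n *: e2 + series (fun n => qk (u n)) n *: e3).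
  apply/funext => n; rewrite /series /= !scaler_suml -!big_split /=.
  by apply: eq_bigr => k _; apply/quaternionP; split=> /=; ring.
by apply: cvgD; [apply: cvgD; [apply: cvgD|]|]; exact: cvgZr_tmp.
Qed.

Lemma subgeometric_has_qseries a : subgeometric a -> exists f, has_qseries f a.
Proof.
move=> ha; suff h q : exists l : H, qball q -> series (fun n => q ^+ n * a n) @ \oo --> l.
  by have [f hf] := choice h; exists f.
have [qb|] := pselect (qball q); last by exists 0.
have [K [x [K0 x01 hK]]] := subgeometric_bound ha (normr_ge0 q) qb.
have [|l hl] := @cvg_series_geom (fun n => q ^+ n * a n) K x x01; last by exists l.
by move=> n; rewrite qnormM qnormX mulrC.
Qed.

Lemma has_qseries_tail f a r : has_qseries f a -> 0 <= r -> r < 1 ->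
  forall e, 0 < e -> exists N0, forall N q, (N0 <= N)%N -> `|q| <= r ->
    `|f q - series (fun n => q ^+ n * a n) N| <= e.
Proof.
move=> fa r0 r1 e e0; have ha := has_qseries_subgeometric fa.
have [K [x [K0 x01 hK]]] := subgeometric_bound ha r0 r1.
have [x0 x1] := andP x01.
have x1' : 0 < 1 - x by rewrite subr_gt0.
have K1 : 0 < K + 1 by rewrite ltr_wpDl.
have [N0 hN0] := expr_small x01 (divr_gt0 (mulr_gt0 e0 x1') K1).
exists N0 => N q NN qr.
have qb : qball q by exact: le_lt_trans qr r1.
apply: (@lim_dist_le _ _ _ _ _ N (fa q qb)).
move=> n Nn; rewrite sub_series_geq //.
apply: (@le_trans _ _ (\sum_(N <= i < n) K * x ^+ i)).
  rewrite (le_trans (ler_norm_sum _ _ _)) // ler_sum // => i _.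
  rewrite qnormM qnormX mulrC (le_trans _ (hK i)) // ler_wpM2l //.
  by rewrite lerXn2r // nnegrE.
rewrite -mulr_sumr -{1}[N]add0n big_addn big_mkord.
under eq_bigr do rewrite exprD.
rewrite -mulr_suml; apply: (@le_trans _ _ ((K + 1) * ((1 - x)^-1 * x ^+ N))).
  rewrite ler_pM ?mulr_ge0 ?sumr_ge0 ?exprn_ge0 // ?lerDl //.
    by move=> i _; rewrite exprn_ge0.
  by rewrite ler_wpM2r ?exprn_ge0 // sum_expr_le.
have := hN0 _ NN; rewrite ler_pdivlMr // => h.
rewrite mulrCA mulrC ler_pdivrMr // mulrC; exact: h.
Qed.

End PowerSeries.

(** * Lipschitz bounds and second-order remainders of power series *)

Section SeriesDerivative.
Variable R : realType.
Local Notation H := (quaternion R).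
Implicit Types (a : nat -> H) (f g : H -> H) (p q w : H) (r x : R).

(** The familiar bound $n|p-q|r^{n-1}$ with one factor [r] moved to the left, so that $n=0$ fits.
    The telescoping identity holds for points of different slices too. *)
Lemma exprB_norm_le p q r n : `|p| <= r -> `|q| <= r ->
  `|p ^+ n - q ^+ n| * r <= n%:R * `|p - q| * r ^+ n.
Proof.
move=> pr qr; have r0 : 0 <= r := le_trans (normr_ge0 _) pr.
elim: n => [|n IH]; first by rewrite subrr normr0 !mul0r.
have -> : p ^+ n.+1 - q ^+ n.+1 = p * (p ^+ n - q ^+ n) + (p - q) * q ^+ n.
  by rewrite !exprS mulrBr mulrBl addrA subrK.
apply: (@le_trans _ _ ((r * `|p ^+ n - q ^+ n| + `|p - q| * r ^+ n) * r)).
  rewrite ler_wpM2r // (le_trans (ler_normD _ _)) // !qnormM lerD //.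
    by rewrite ler_wpM2r.
  by rewrite ler_wpM2l // qnormX lerXn2r // nnegrE.
have := ler_wpM2l r0 IH; rewrite -(natr1 n) [r ^+ n.+1]exprS.
move: (r ^+ n) `|p - q| `|_| n%:R => S W D m {}IH.
rewrite -subr_ge0 in IH; rewrite -subr_ge0; apply: le_trans IH _.
by rewrite le_eqVlt; apply/orP; left; apply/eqP; ring.
Qed.

(** Commutation of [q] and [w] collects the linear terms into $nwq^{n-1}$; increments inside the
    slice of [q] have this property. Moving $r^2$ to the left avoids the exponent $n-2$. *)
Lemma exprD_norm_le q w r n : q * w = w * q -> `|q| <= r -> `|q + w| <= r ->
  `|(q + w) ^+ n - q ^+ n - n%:R *: (w * q ^+ n.-1)| * r ^+ 2 <=
  n%:R ^+ 2 * `|w| ^+ 2 * r ^+ n.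
Proof.
move=> qw qr qwr; have r0 : 0 <= r := le_trans (normr_ge0 _) qr.
elim: n => [|n IH].
  by rewrite subrr scale0r subrr normr0 mul0r expr0n /= !mul0r.
have -> : (q + w) ^+ n.+1 - q ^+ n.+1 - n.+1%:R *: (w * q ^+ n) =
    (q + w) * ((q + w) ^+ n - q ^+ n - n%:R *: (w * q ^+ n.-1)) +
    n%:R *: (w * w * q ^+ n.-1).
  case: n {IH} => [|n]; first by rewrite !expr1 expr0 !scale0r subr0 subrr mulr0 addr0 scale1r
    mulr1 [q + w]addrC addrK subrr.
  rewrite -[n.+1.-1]/n -(natr1 n.+1) scalerDl scale1r.
  have qwn : q * (w * q ^+ n) = w * q ^+ n.+1 by rewrite mulrA qw -mulrA -exprS.
  rewrite [in LHS]exprS !mulrBr -[in X in _ = _ - X + _]scalerAr [(q + w) * (w * _)]mulrDl qwn.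
  rewrite scalerDr -(mulrA w w).
  rewrite [(q + w) * q ^+ _]mulrDl -(exprS (q + w)).
  rewrite -(exprS q n.+1).
  move: ((q + w) ^+ _) (q ^+ n.+2) (w * q ^+ n.+1) (w * (w * _)) (n.+1%:R) => A B C D m.
  by apply/quaternionP; split=> /=; ring.
apply: (@le_trans _ _ ((r * `|(q + w) ^+ n - q ^+ n - n%:R *: (w * q ^+ n.-1)|
    + n%:R * (`|w| ^+ 2 * `|q ^+ n.-1|)) * r ^+ 2)).
  rewrite ler_wpM2r ?exprn_ge0 // (le_trans (ler_normD _ _)) // qnormM lerD ?ler_wpM2r //.
  by rewrite normrZ normr_nat !qnormM.
apply: (@le_trans _ _ (r * (n%:R ^+ 2 * `|w| ^+ 2 * r ^+ n) + n%:R * `|w| ^+ 2 * r ^+ n.+1)).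
  rewrite mulrDl -mulrA lerD ?ler_wpM2l //.
  case: n {IH} => [|n]; first by rewrite !mul0r.
  rewrite -!mulrA !ler_wpM2l // qnormX.
  rewrite -[n.+2]addn2 exprD ler_wpM2r ?exprn_ge0 //.
  by rewrite lerXn2r // nnegrE.
rewrite -(natr1 n) [r ^+ n.+1]exprS -subr_ge0.
set m := n%:R; have m0 : 0 <= m by exact: ler0n.
have -> : (m + 1) ^+ 2 * `|w| ^+ 2 * (r * r ^+ n) -
  (r * (m ^+ 2 * `|w| ^+ 2 * r ^+ n) + m * `|w| ^+ 2 * (r * r ^+ n)) =
  (m + 1) * (`|w| ^+ 2 * (r * r ^+ n)) by ring.
by rewrite !mulr_ge0 ?exprn_ge0 ?addr_ge0.
Qed.

Lemma qseries_lipschitz f a r : has_qseries f a -> 0 < r -> r < 1 ->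
  exists2 K, 0 <= K & forall p q, `|p| <= r -> `|q| <= r -> `|f p - f q| <= K * `|p - q|.
Proof.
move=> fa r0 r1; have ha := has_qseries_subgeometric fa.
have [K K0 hK] := subgeometric_sum_le (subgeometric_natmul ha) (ltW r0) r1.
exists (K / r); first by rewrite divr_ge0 // ltW.
move=> p q pr qr.
pose u p := series (fun n => p ^+ n * a n).
have pq : (fun N => u p N - u q N) @ \oo --> f p - f q.
  by apply: cvgB; [exact: fa (le_lt_trans pr r1) | exact: fa (le_lt_trans qr r1)].
apply: (lim_norm_le pq) => N; rewrite /u /series /=.
rewrite -sumrB big_mkord; apply: le_trans (ler_norm_sum _ _ _) _.
apply: (@le_trans _ _ (\sum_(n < N) `|n.+1%:R *: a n| * r ^+ n * (`|p - q| / r))).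
  apply: ler_sum => n _; rewrite -mulrBl qnormM normrZ normr_nat.
  rewrite [leRHS]mulrA ler_pdivlMr // mulrAC.
  have -> : n.+1%:R * `|a n| * r ^+ n * `|p - q| = n.+1%:R * `|p - q| * r ^+ n * `|a n|.
    by rewrite mulrAC [X in X * _]mulrAC mulrAC.
  rewrite ler_wpM2r //.
  apply: le_trans (exprB_norm_le n pr qr) _.
  rewrite ler_wpM2r ?exprn_ge0 ?(ltW r0) //.
  by rewrite ler_wpM2r // ler_nat.
rewrite -mulr_suml mulrAC -mulrA ler_wpM2r ?divr_ge0 // ?ltW //.
Qed.

Lemma qseries_derivative f g a r :
  has_qseries f a -> has_qseries g (fun n => n.+1%:R *: a n.+1) -> 0 < r -> r < 1 ->
  exists2 K, 0 <= K & forall q w, q * w = w * q -> `|q| <= r -> `|q + w| <= r ->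
    `|f (q + w) - f q - w * g q| <= K * `|w| ^+ 2.
Proof.
move=> fa ga r0 r1; have ha := has_qseries_subgeometric fa.
have ha2 := subgeometric_natmul (subgeometric_natmul ha).
have [K K0 hK] := subgeometric_sum_le ha2 (ltW r0) r1.
have r2 : 0 < r ^+ 2 by rewrite exprn_gt0.
exists (K / r ^+ 2); first by rewrite divr_ge0 // ltW.
move=> q w qw qr qwr.
pose u b p := series (fun n => p ^+ n * b n).
(* Partial sums of [f] take one term more than those of [g], since differentiation drops the
   constant term; then the difference is a sum of remainders of single powers. *)
have h1 : (fun N => u a (q + w) N.+1) @ \oo --> f (q + w).
  by rewrite cvg_shiftS; apply: fa (le_lt_trans qwr r1).
have h2 : (fun N => u a q N.+1) @ \oo --> f q.
  by rewrite cvg_shiftS; apply: fa (le_lt_trans qr r1).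
have h3 := cvg_qmull (q := w) (ga q (le_lt_trans qr r1)).
have h4 : (fun N => u a (q + w) N.+1 - u a q N.+1 - w * u (fun n => n.+1%:R *: a n.+1) q N)
    @ \oo --> f (q + w) - f q - w * g q.
  by apply: cvgB h3; exact: cvgB.
apply: (lim_norm_le h4) => N.
have -> : u a (q + w) N.+1 - u a q N.+1 - w * u (fun n => n.+1%:R *: a n.+1) q N =
   \sum_(n < N.+1) ((q + w) ^+ n - q ^+ n - n%:R *: (w * q ^+ n.-1)) * a n.
  under [RHS]eq_bigr do rewrite !mulrBl.
  rewrite /u /series /= !big_mkord !sumrB; congr (_ - _).
  rewrite [RHS]big_ord_recl scale0r mul0r add0r mulr_sumr; apply: eq_bigr => n _.
  by rewrite -scalerAl -!scalerAr mulrA.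
apply: le_trans (ler_norm_sum _ _ _) _.
apply: (@le_trans _ _ (\sum_(n < N.+1) `|n.+1%:R *: (n.+1%:R *: a n)| * r ^+ n * (`|w| ^+ 2 /
  r ^+ 2))).
  apply: ler_sum => n _; rewrite qnormM !normrZ normr_nat.
  rewrite [leRHS]mulrA ler_pdivlMr // mulrAC.
  have -> : n.+1%:R * (n.+1%:R * `|a n|) * r ^+ n * `|w| ^+ 2 =
    n.+1%:R ^+ 2 * `|w| ^+ 2 * r ^+ n * `|a n| by rewrite expr2; ring.
  rewrite ler_wpM2r //; apply: le_trans (exprD_norm_le n qw qr qwr) _.
  rewrite ler_wpM2r ?exprn_ge0 ?(ltW r0) // ler_wpM2r ?exprn_ge0 //.
  by rewrite lerXn2r ?nnegrE // ler_nat.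
rewrite -mulr_suml [leRHS]mulrAC -mulrA ler_wpM2r ?divr_ge0 ?exprn_ge0 ?(ltW r0) //.
Qed.

Lemma derive1_quadratic (V : normedModType R) (phi : R -> V) x (d : V) K e : 0 < e -> 0 <= K ->
  (forall h, `|h| <= e -> `|phi (x + h) - phi x - h *: d| <= K * h ^+ 2) ->
  derivable phi x 1 /\ phi^`()%classic x = d.
Proof.
move=> e0 K0 hphi.
have lim1 : (fun h => h^-1 *: (phi (h + x) - phi x)) @ 0^' --> d.
  apply/cvgrPdist_le => eta eta0.
  have K1 : 0 < K + 1 by rewrite ltr_wpDl.
  have m0 : 0 < Num.min e (eta / (K + 1)) by rewrite lt_min e0 divr_gt0.
  near=> h.
  have h0 : h != 0 by near: h; exact: nbhs_dnbhs_neq.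
  have : `|h| <= Num.min e (eta / (K + 1)).
    near: h; apply: dnbhs0_le; exact: m0.
  rewrite le_min => /andP[he heta].
  have -> : d - h^-1 *: (phi (h + x) - phi x) = - (h^-1 *: (phi (x + h) - phi x - h *: d)).
    by rewrite [x + h]addrC [in RHS]scalerBr scalerA mulVf // scale1r opprB.
  rewrite normrN normrZ normfV ler_pdivrMl ?normr_gt0 //.
  apply: le_trans (hphi h he) _; rewrite -real_normK ?num_real // expr2.
  rewrite mulrCA ler_wpM2l //; apply: (@le_trans _ _ ((K + 1) * `|h|)).
    by rewrite ler_wpM2r // lerDl.
  by rewrite mulrC -ler_pdivlMr.
have lim2 : (fun h => h^-1 *: (phi (h *: 1 + x) - phi x)) @ 0^' --> d.
  suff -> : (fun h => h^-1 *: (phi (h *: 1 + x) - phi x)) = (fun h =>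
    h^-1 *: (phi (h + x) - phi x)) by [].
  by apply/funext => h; rewrite [h *: 1]mulr1.
split; first by apply/cvg_ex; exists d.
exact: (cvg_lim (@norm_hausdorff _ _) lim1).
Unshelve. all: by end_near. Qed.

End SeriesDerivative.

(** * Power series are slice regular, with the termwise slice derivative *)

Section SliceDerivative.
Variable R : realType.
Local Notation H := (quaternion R).
Implicit Types (a : nat -> H) (f g : H -> H) (I p q w : H) (r x y : R).

Lemma slice_derivs f g a I x y :
  has_qseries f a -> has_qseries g (fun n => n.+1%:R *: a n.+1) ->
  qimag_units I -> qball (slice_pt I x y) ->
  [/\ derivable (fun t => f (slice_pt I t y)) x 1,
      derivable (fun t => f (slice_pt I x t)) y 1,
      slice_dx f I x y = g (slice_pt I x y) &
      slice_dy f I x y = I * g (slice_pt I x y)].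
Proof.
move=> fa ga hI; rewrite /qball /=; set q := slice_pt I x y => qb.
(* Here $|q|+e=r<1$: steps of length at most [e] stay in the closed ball of radius [r]. *)
pose r := (1 + `|q|) / 2; pose e := (1 - `|q|) / 2.
have q0 : 0 <= `|q| by [].
have r0 : 0 < r by rewrite /r; lra.
have r1 : r < 1 by rewrite /r; lra.
have e0 : 0 < e by rewrite /e; lra.
have [K K0 hK] := qseries_derivative fa ga r0 r1.
have near_q (v : H) h : `|v| = 1 -> `|h| <= e -> `|q + h *: v| <= r.
  move=> v1 he; rewrite (le_trans (ler_normD _ _)) // normrZ v1 mulr1.
  by move: he; rewrite /r /e; lra.
have hx h : `|h| <= e ->
    `|f (slice_pt I (x + h) y) - f q - h *: g q| <= K * h ^+ 2.
  move=> he; have qr : `|q| <= r by rewrite /r; lra.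
  have := hK q (h *: 1) (esym (qscaleC h q)) qr (near_q _ _ (qnorm1 R) he).
  rewrite -scalerAl mul1r normrZ qnorm1 mulr1 real_normK ?num_real //.
  by have -> : q + h *: 1 = slice_pt I (x + h) y by rewrite /q /slice_pt scalerDl addrAC.
have hy h : `|h| <= e ->
    `|f (slice_pt I x (y + h)) - f q - h *: (I * g q)| <= K * h ^+ 2.
  move=> he; have [_ nI] := (imag_unitP I).1 hI.
  have qc : q * (h *: I) = (h *: I) * q.
    by have := slice_pt_comm I x y 0 h; rewrite [slice_pt I 0 h]/slice_pt scale0r add0r.
  have qr : `|q| <= r by rewrite /r; lra.
  have := hK q (h *: I) qc qr (near_q _ _ nI he).
  rewrite -scalerAl normrZ nI mulr1 real_normK ?num_real //.
  by have -> : q + h *: I = slice_pt I x (y + h) by rewrite /q /slice_pt scalerDl addrA.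
have [dx ex] := derive1_quadratic (phi := fun t => f (slice_pt I t y)) e0 K0 hx.
by have [dy ey] := derive1_quadratic (phi := fun t => f (slice_pt I x t)) e0 K0 hy; split.
Qed.

Lemma slice_deriv_qseries f g a I x y :
  has_qseries f a -> has_qseries g (fun n => n.+1%:R *: a n.+1) ->
  qimag_units I -> qball (slice_pt I x y) ->
  slice_deriv f I x y = g (slice_pt I x y).
Proof.
move=> fa ga hI qb; have [_ _ ex ey] := slice_derivs fa ga hI qb.
rewrite /slice_deriv ex ey mulrA -expr2 hI mulN1r opprK.
by rewrite -mulr2n -[X in _ *: X]scaler_nat scalerA mulVf ?scale1r // pnatr_eq0.
Qed.

Lemma qseries_slice_continuous g b I x y :
  has_qseries g b -> qimag_units I -> qball (slice_pt I x y) -> forall e, 0 < e ->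
  \forall z \near (x, y), qball (slice_pt I z.1 z.2) /\
    `|g (slice_pt I x y) - g (slice_pt I z.1 z.2)| <= e.
Proof.
move=> gb hI; rewrite /qball /=; set q := slice_pt I x y => qb e e0.
have q0 : 0 <= `|q| by [].
pose r := (1 + `|q|) / 2.
have r0 : 0 < r by rewrite /r; lra.
have r1 : r < 1 by rewrite /r; lra.
have [K K0 hK] := qseries_lipschitz gb r0 r1.
have K1 : 0 < K + 1 by rewrite ltr_wpDl.
(* The two coordinates together move the point by at most $2d$: the first bound keeps it within
   radius [r], the second makes $(K+1)2d\le e$. *)
pose d := Num.min ((1 - `|q|) / 4) (e / (K + 1) / 2).
have d0 : 0 < d by rewrite lt_min !divr_gt0 // subr_gt0.
have : d <= d by []; rewrite {2}/d le_min => /andP[d1 d2].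
near=> z.
have [z1 z2] : `|x - z.1| < d /\ `|y - z.2| < d.
  by near: z; apply/nbhs_ballP; exists d => // z [].
have zd : `|q - slice_pt I z.1 z.2| <= 2 * d.
  have -> : q - slice_pt I z.1 z.2 = (x - z.1) *: 1 + (y - z.2) *: I.
    by rewrite /q /slice_pt !scalerBl opprD addrACA.
  rewrite (le_trans (ler_normD _ _)) // !normrZ qnorm1.
  have [_ ->] := (imag_unitP I).1 hI; lra.
have zr : `|slice_pt I z.1 z.2| <= r.
  have -> : slice_pt I z.1 z.2 = q - (q - slice_pt I z.1 z.2) by rewrite subKr.
  by rewrite (le_trans (ler_normB _ _)) // /r; lra.
split; first exact: le_lt_trans zr r1.
apply: le_trans (hK _ _ _ zr) _; first by rewrite /r; lra.
apply: (@le_trans _ _ ((K + 1) * (2 * d))).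
  by rewrite ler_pM // lerDl.
rewrite mulrC -ler_pdivlMr //; lra.
Unshelve. all: by end_near. Qed.

Lemma has_qseries0 f a : has_qseries f a -> f 0 = a 0%N.
Proof.
move=> fa; have := fa 0; rewrite /qball /= normr0 => /(_ ltr01) h.
apply: (cvgn_unique h); apply/seq_cvgP => e e0; exists 1%N => -[//|n] _.
rewrite /series /= big_mkord big_ord_recl big1 ?addr0.
  by rewrite expr0 mul1r subrr normr0 ltW.
by move=> i _; rewrite exprS mul0r mul0r.
Qed.

Lemma slice_regular_qseries f g a :
  has_qseries f a -> has_qseries g (fun n => n.+1%:R *: a n.+1) -> slice_regular f.
Proof.
move=> fa ga I hI; split=> x y qb; have [dx dy ex ey] := slice_derivs fa ga hI qb.
  split=> //; apply/cvgrPdist_le => e e0 /=.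
    apply: filterS (qseries_slice_continuous ga hI qb e0) => z [zb].
    by have [_ _ -> _] := slice_derivs fa ga hI zb; rewrite ex.
  apply: filterS (qseries_slice_continuous ga hI qb e0) => z [zb].
  have [_ _ _ ->] := slice_derivs fa ga hI zb; rewrite ey -mulrBr qnormM.
  by have [_ ->] := (imag_unitP I).1 hI; rewrite mul1r.
by rewrite ex ey mulrA -expr2 hI mulN1r subrr scaler0.
Qed.

Lemma slice_starlike_qseries f g a :
  has_qseries f a -> has_qseries g (fun n => n.+1%:R *: a n.+1) ->
  a 0%N = 0 -> a 1%N = 1 ->
  (forall q, qball q -> q != 0 -> 0 < qre ((f q)^-1 * q * g q)) ->
  slice_starlike f.
Proof.
move=> fa ga a0 a1 pos; split.
  split; first exact: slice_regular_qseries fa ga.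
    apply/seteqP; split=> [q [qb fq] /=|q /= ->].
      (* Since the inverse of 0 is 0, a zero off the origin would give real part 0, against strict
         positivity. *)
      apply/eqP; apply: contraT => /(pos q qb).
      by rewrite fq invr0 !mul0r ltxx.
    by split; [rewrite /qball /= normr0 | rewrite (has_qseries0 fa)].
  move=> I hI; have s0 : slice_pt I 0 0 = 0 by rewrite /slice_pt !scale0r addr0.
  rewrite (slice_deriv_qseries fa ga) ?s0 ?(has_qseries0 ga) ?a1 ?scale1r //.
  by rewrite /qball /= normr0.
move=> I x y hI q qb q0; rewrite (slice_deriv_qseries fa ga) //.
exact: pos.
Qed.

End SliceDerivative.

(** * Compactness of closed balls *)

Section Compactness.
Variable R : realType.
Local Notation H := (quaternion R).

(** The ball is a closed subset of the linear image of the compact box $[-r,r]^4$. *)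
Lemma closed_qball_compact (r : R) : compact [set q : H | `|q| <= r].
Proof.
pose e0 : H := Quaternion 1 0 0 0; pose e1 : H := Quaternion 0 1 0 0.
pose e2 : H := Quaternion 0 0 1 0; pose e3 : H := Quaternion 0 0 0 1.
pose Q (t : R * R * R * R) : H := t.1.1.1 *: e0 + t.1.1.2 *: e1 + t.1.2 *: e2 + t.2 *: e3.
have Qc : continuous Q.
  move=> t; apply: cvgD; [apply: cvgD; [apply: cvgD|]|]; apply: cvgZr_tmp.
  - apply: (@cvg_comp _ _ _ (fun t : R * R * R * R => t.1.1) fst _ (nbhs t.1.1));
    last exact: cvg_fst.
    by apply: (@cvg_comp _ _ _ (fun t : R * R * R * R => t.1) fst _ (nbhs t.1)); exact: cvg_fst.
  - apply: (@cvg_comp _ _ _ (fun t : R * R * R * R => t.1.1) snd _ (nbhs t.1.1));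
    last exact: cvg_snd.
    by apply: (@cvg_comp _ _ _ (fun t : R * R * R * R => t.1) fst _ (nbhs t.1)); exact: cvg_fst.
  - by apply: (@cvg_comp _ _ _ (fun t : R * R * R * R => t.1) snd _ (nbhs t.1));
    [exact: cvg_fst | exact: cvg_snd].
  - exact: cvg_snd.
pose box : set (R * R * R * R) := `[- r, r] `*` `[- r, r] `*` `[- r, r] `*` `[- r, r].
have boxc : compact (Q @` box).
  apply: continuous_compact; first exact: continuous_subspaceT.
  by do !apply: compact_setX; exact: segment_compact.
apply: (subclosed_compact _ boxc).
  by apply: (@closed_comp _ _ (fun q : H => `|q|) [set x | x <= r]); [move=> q _;
    exact: norm_continuous | exact: closed_le].
move=> q /= qr; exists (quaternion_tuple q); last first.
  by apply/quaternionP; split=> /=; ring.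
have sq c : c ^+ 2 <= qsqnorm q -> `[- r, r]%classic c.
  rewrite -qnorm_sqr => h; rewrite /= in_itv /= -ler_norml.
  apply: le_trans qr; rewrite -(ler_pXn2r (n := 2)) ?nnegrE // real_normK ?num_real //.
by split; [split; [split|]|]; apply: sq; rewrite /qsqnorm /=;
  move: (qre q) (qi q) (qj q) (qk q) => a b c d; nra.
Qed.

Lemma positive_lower_bound (phi : H -> R) (r K : R) : 0 <= r -> 0 <= K ->
  (forall p q, `|p| <= r -> `|q| <= r -> `|phi p - phi q| <= K * `|p - q|) ->
  (forall q, `|q| <= r -> 0 < phi q) ->
  exists2 m, 0 < m & forall q, `|q| <= r -> m <= phi q.
Proof.
move=> r0 K0 lip pos.
have [||c /[!inE]/= cr hc] := @compact_EVT_min _ _ phi _ _ (@closed_qball_compact r).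
- by exists 0; rewrite /= normr0.
- apply/subspace_continuousP => q /= qr; apply/cvgrPdist_le => e e0.
  have K1 : 0 < K + 1 by rewrite ltr_wpDl.
  rewrite near_withinE; near=> p => pr.
  apply: le_trans (lip q p qr pr) _; apply: (@le_trans _ _ ((K + 1) * `|q - p|)).
    by rewrite ler_wpM2r // lerDl.
  rewrite mulrC -ler_pdivlMr //; near: p.
  by apply: cvgr_dist_le; [exact: cvg_id | rewrite divr_gt0].
by exists (phi c); [exact: pos | move=> q qr; apply: hc; rewrite inE].
Unshelve. all: by end_near. Qed.

End Compactness.

(** * The coefficient estimate *)

Section FeketeSzego.
Variable R : realType.
Local Notation H := (quaternion R).
Implicit Types (a : nat -> H) (f g : H -> H) (p q w : H) (r x y : R).

(** The expansion in the theorem prescribes the terms of degree 0 and 1 and reads [a] from index 2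
    on; this is the full coefficient sequence. *)
Definition normalized a n : H :=
  match n with 0%N => 0 | 1%N => 1 | _ => a n end.

Lemma normalized_has_qseries f a :
  (forall q, qball q -> (fun N => q + \sum_(2 <= n < N) q ^+ n * a n) @ \oo --> f q) <->
  has_qseries f (normalized a).
Proof.
have e q N : (2 <= N)%N ->
    q + \sum_(2 <= n < N) q ^+ n * a n = series (fun n => q ^+ n * normalized a n) N.
  move=> N2; rewrite /series /=.
  rewrite (@big_ltn _ _ _ 0) ?(leq_trans _ N2) // (@big_ltn _ _ _ 1) // mulr0 add0r expr1 mulr1.
  by congr (_ + _); apply: eq_big_nat => -[|[]].
split=> h q qb; have /seq_cvgP hq := h q qb; apply/seq_cvgP => d /hq[N hN];
  exists (maxn N 2) => n; rewrite geq_max => /andP[/hN nN /(e q) n2].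
  by rewrite -n2.
by rewrite n2.
Qed.

Lemma seval_widen (P : {poly H}) q n : (size P <= n)%N ->
  seval P q = \sum_(k < n) q ^+ k * P`_k.
Proof.
move=> le; rewrite /seval (big_ord_widen n (fun k => q ^+ k * P`_k)) //.
rewrite big_mkcond; apply: eq_bigr => k _; case: ltnP => // ?.
by rewrite nth_default // mulr0.
Qed.

(** Here $F=h$, $G=f'$ and $s_n=a_{n+1}$. On the closed ball of radius [r] the pairing has a
    positive minimum, so truncations close enough to [F] and [G] still pair positively. The
    polynomial with coefficients $r^ks_k$ takes these truncated values on the closed unit ball, and
    its coefficients 1 and 2 carry $r$ and $r^2$. *)
Lemma fekete_szego_scaled (F G : H -> H) (s : nat -> H) lam r :
  has_qseries F s -> has_qseries G (fun n => n.+1%:R *: s n) -> s 0%N = 1 ->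
  (forall q, qball q -> 0 < qre (qconj (F q) * G q)) ->
  0 < r -> r < 1 ->
  r ^+ 2 * `|s 2%N - lam * s 1%N ^+ 2| <= Num.max 1 `|4 * lam - 3|.
Proof.
move=> Fs Gs s0 pos r0 r1.
have rb q : `|q| <= r -> qball q by move=> qr; exact: le_lt_trans qr r1.
have [K K0 lipF] := qseries_lipschitz Fs r0 r1.
have [L L0 lipG] := qseries_lipschitz Gs r0 r1.
have F0 : F 0 = 1 by rewrite (has_qseries0 Fs).
have G0 : G 0 = 1 by rewrite (has_qseries0 Gs) s0 scale1r.
pose B := 1 + K + L.
have B1 : 1 <= B by rewrite /B; lra.
have r00 : `|0 : H| <= r by rewrite normr0 ltW.
have FB q : `|q| <= r -> `|F q| <= B.
  move=> qr; have := lipF q 0 qr r00; rewrite F0 subr0 => h.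
  have -> : F q = (F q - 1) + 1 by rewrite subrK.
  rewrite (le_trans (ler_normD _ _)) // qnorm1.
  have : K * `|q| <= K by rewrite ler_piMr // (le_trans qr) // ltW.
  by rewrite /B; lra.
have GB q : `|q| <= r -> `|G q| <= B.
  move=> qr; have := lipG q 0 qr r00; rewrite G0 subr0 => h.
  have -> : G q = (G q - 1) + 1 by rewrite subrK.
  rewrite (le_trans (ler_normD _ _)) // qnorm1.
  have : L * `|q| <= L by rewrite ler_piMr // (le_trans qr) // ltW.
  by rewrite /B; lra.
have pair_dist (u v z t : H) : `|qre (qconj u * v) - qre (qconj z * t)| <=
    `|u - z| * `|v| + `|z| * `|v - t|.
  have -> : qre (qconj u * v) - qre (qconj z * t) =
      qre (qconj (u - z) * v + qconj z * (v - t)).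
    rewrite -[LHS]/(qre (qconj u * v - qconj z * t)); congr qre.
    by rewrite raddfB /= mulrBl mulrBr addrA subrK.
  apply: le_trans (qre_norm _) _; apply: le_trans (ler_normD _ _) _.
  by rewrite !qnormM !qnorm_conj.
have [m m0 hm] : exists2 m, 0 < m & forall q, `|q| <= r -> m <= qre (qconj (F q) * G q).
  apply: (@positive_lower_bound _ _ r (B * (K + L))) => //; first exact: ltW.
  - by rewrite mulr_ge0 ?addr_ge0 // (le_trans ler01).
  - move=> p q pr qr; apply: le_trans (pair_dist _ _ _ _) _.
    rewrite mulrDr mulrDl lerD //.
      rewrite [leLHS]mulrC -mulrA ler_pM //; [exact: GB | exact: lipF].
    rewrite -mulrA ler_pM //; [exact: FB | exact: lipG].
  - by move=> q /rb; exact: pos.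
(* Truncation changes the pairing by at most $dB+(B+1)d=(2B+1)d<m$; the bound $d\le1$ keeps the
   truncation of [F] below $B+1$. *)
pose d := Num.min 1 (m / (2 * B + 2)).
have d0 : 0 < d by rewrite lt_min ltr01 divr_gt0 //; lra.
have : d <= d by []; rewrite {2}/d le_min => /andP[d1 dm].
have [N1 hN1] := has_qseries_tail Fs (ltW r0) r1 d0.
have [N2 hN2] := has_qseries_tail Gs (ltW r0) r1 d0.
pose N := maxn 3 (maxn N1 N2).
have N3 : (3 <= N)%N by exact: leq_maxl.
have {}hN1 q := hN1 N q (leq_trans (leq_maxl _ _) (leq_maxr _ _)).
have {}hN2 q := hN2 N q (leq_trans (leq_maxr _ _) (leq_maxr _ _)).
pose P : {poly H} := \poly_(k < N) (r ^+ k *: s k).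
have coefP k : (k < N)%N -> P`_k = r ^+ k *: s k by move=> kN; rewrite coef_poly kN.
have sP : (size P <= N)%N by exact: size_poly.
have sQ : (size (P * 'X)^`() <= N)%N.
  rewrite (leq_trans (size_poly _ _)) //.
  have : (size (P * 'X)%R <= N.+1)%N.
    by rewrite (leq_trans (size_polyMleq _ _)) // size_polyX addn2.
  by case: (size _).
have evP (x : H) : seval P x = series (fun n => (r *: x) ^+ n * s n) N.
  rewrite (seval_widen _ sP) /series /= big_mkord; apply: eq_bigr => k _.
  by rewrite coefP // exprZn -scalerAl -scalerAr.
have evQ (x : H) : seval (P * 'X)^`() x = series (fun n => (r *: x) ^+ n * (n.+1%:R *: s n)) N.
  rewrite (seval_widen _ sQ) /series /= big_mkord; apply: eq_bigr => k _.
  rewrite coef_deriv coefMX /= coefP // exprZn -scalerAl -scaler_nat.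
  by rewrite !scalerA mulrC -scalerA -scalerAr -!scalerAr.
have P0 : P`_0 = 1 by rewrite coefP ?(leq_trans _ N3) // expr0 scale1r s0.
have := @fekete_szego_poly R P lam P0.
rewrite !coefP ?(leq_trans _ N3) // expr1 => h; apply: le_trans (h _); last first.
  move=> x x1; rewrite evP evQ; set q := r *: x.
  have qr : `|q| <= r by rewrite normrZ gtr0_norm // ler_piMr // ltW.
  set u := series _ _; set v := series _ _.
  have := pair_dist (F q) (G q) u v.
  have hu : `|F q - u| <= d := hN1 q qr.
  have hv : `|G q - v| <= d := hN2 q qr.
  have uB : `|u| <= B + 1.
    have -> : u = F q - (F q - u) by rewrite subKr.
    by rewrite (le_trans (ler_normB _ _)) // lerD // ?FB // (le_trans hu).
  move=> {}h; have {}h : `|qre (qconj (F q) * G q) - qre (qconj u * v)| <= d * B + (B + 1) * d.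
    by apply: le_trans h _; rewrite lerD // ler_pM // GB.
  have := hm q qr; move: h; rewrite ler_norml => /andP[_].
  move: dm; rewrite ler_pdivlMr; last by lra.
  set X := qre _; set Y := qre _ => a1 a2 a3.
  nra.
have -> : r ^+ 2 *: s 2%N - lam * (r *: s 1%N) ^+ 2 = r ^+ 2 *: (s 2%N - lam * s 1%N ^+ 2).
  by rewrite exprZn scalerBr -scalerAr.
by rewrite normrZ ger0_norm // exprn_ge0 // ltW.
Qed.

Lemma fekete_szego f a lam : slice_starlike f ->
  (forall q, qball q -> (fun N => q + \sum_(2 <= n < N) q ^+ n * a n) @ \oo --> f q) ->
  `|a 3%N - lam * a 2%N ^+ 2| <= Num.max 1 `|4 * lam - 3|.
Proof.
move=> [[_ zf _] star] /normalized_has_qseries fb.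
pose s n := normalized a n.+1.
have hs : subgeometric s by apply: subgeometric_shift; exact: has_qseries_subgeometric fb.
have [F Fs] := subgeometric_has_qseries hs.
have [G Gs] := subgeometric_has_qseries (subgeometric_natmul hs).
have fF q : qball q -> f q = q * F q.
  move=> qb; have h1 := fb q qb; have h2 := cvg_qmull (q := q) (Fs q qb).
  move: h1; rewrite -cvg_shiftS => h1; apply: (cvgn_unique h1).
  suff -> : [sequence series (fun n => q ^+ n * normalized a n) n.+1]_n =
    (fun N => q * series (fun n => q ^+ n * s n) N) by [].
  apply/funext => N; rewrite /series /= big_nat_recl // mulr0 add0r mulr_sumr.
  by apply: eq_bigr => n _; rewrite exprS mulrA.
have pos q : qball q -> 0 < qre (qconj (F q) * G q).
  move=> qb; have [->|q0] := eqVneq q 0.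
    by rewrite (has_qseries0 Fs) (has_qseries0 Gs) scale1r -[s 0%N]/(1 : H) qconj1 mulr1 ltr01.
  have [I [x [y [hI eq]]]] := slice_ptP q.
  have : 0 < qre ((f q)^-1 * q * slice_deriv f I x y).
    by rewrite eq; apply: star; rewrite -?eq.
  rewrite (slice_deriv_qseries fb Gs) -?eq // fF //.
  have F0 : F q != 0.
    apply/eqP => F0; have : [set 0] q by rewrite -zf; split=> //; rewrite fF // F0 mulr0.
    by move=> /= q00; rewrite q00 eqxx in q0.
  by rewrite qre_quotient_gt0.
have main r : 0 < r -> r < 1 -> r ^+ 2 * `|a 3%N - lam * a 2%N ^+ 2| <= Num.max 1 `|4 * lam - 3|.
  by move=> r0 r1; exact: (fekete_szego_scaled lam Fs Gs).
set A := `|_| in main *; set C := Num.max _ _ in main *.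
rewrite leNgt; apply/negP => CA.
have C1 : 1 <= C by rewrite le_max lexx.
have A0 : 0 < A by lra.
(* If $A>C$, the dilation bound at radius $(1+r)/2$ reads $(1+r)^2A/4\le C=rA$, which contradicts
   $(1-r)^2A>0$. *)
pose r := C / A.
have r0 : 0 < r by rewrite divr_gt0 //; lra.
have r1 : r < 1 by rewrite ltr_pdivrMr // mul1r.
have rA : r * A = C by rewrite divfK // gt_eqF.
have h : ((1 + r) / 2) ^+ 2 * A <= C by apply: main; lra.
have r2 : 0 < (1 - r) ^+ 2 * A by rewrite mulr_gt0 // exprn_gt0 // subr_gt0.
clearbody r A C; clear -h rA r2; nra.
Qed.

End FeketeSzego.

(** * Extremal functions *)

Section SeriesAlgebra.
Variable R : realType.
Local Notation H := (quaternion R).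
Implicit Types (a b c : nat -> H) (f g F G : H -> H) (I J p q u w : H) (r t x y : R).

Lemma has_qseries_eq f g a b : has_qseries f a ->
  (forall q, qball q -> g q = f q) -> (forall n, b n = a n) -> has_qseries g b.
Proof. by move=> fa gf /funext -> q qb; rewrite gf //; exact: fa. Qed.

Lemma has_qseriesD f g a b : has_qseries f a -> has_qseries g b ->
  has_qseries (fun q => f q + g q) (fun n => a n + b n).
Proof.
move=> fa gb q qb.
have -> : series (fun n => q ^+ n * (a n + b n)) =
    (fun N => series (fun n => q ^+ n * a n) N + series (fun n => q ^+ n * b n) N).
  by apply/funext => N; rewrite /series /= -big_split; apply: eq_bigr => n _; rewrite mulrDr.
by apply: cvgD; [exact: fa | exact: gb].
Qed.

Lemma has_qseriesZ t f a : has_qseries f a ->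
  has_qseries (fun q => t *: f q) (fun n => t *: a n).
Proof.
move=> fa q qb; have := cvg_qmull (q := t%:A) (fa q qb); rewrite -scalerAl mul1r.
suff -> : (fun N => t%:A * series (fun n => q ^+ n * a n) N) =
    series (fun n => q ^+ n * (t *: a n)) by [].
apply/funext => N; rewrite /series /= -scalerAl mul1r scaler_sumr.
by apply: eq_bigr => n _; rewrite scalerAr.
Qed.

Definition delay a n : H := if n is m.+1 then a m else 0.

Lemma has_qseries_delay f a : has_qseries f a ->
  has_qseries (fun q => q * f q) (delay a).
Proof.
move=> fa q qb; have := cvg_qmull (q := q) (fa q qb).
rewrite -[X in _ -> X]cvg_shiftS.
suff -> : [sequence series (fun n => q ^+ n * delay a n) n.+1]_n =
    (fun N => q * series (fun n => q ^+ n * a n) N) by [].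
apply/funext => N; rewrite /series /= big_nat_recl // mulr0 add0r mulr_sumr.
by apply: eq_bigr => n _; rewrite exprS mulrA.
Qed.

Definition const_coef (k : H) n : H := if n is 0%N then k else 0.

Lemma has_qseries_const (k : H) : has_qseries (fun=> k) (const_coef k).
Proof.
move=> q _; apply/seq_cvgP => e e0; exists 1%N => -[//|n] _.
rewrite /series /= big_mkord big_ord_recl big1 ?addr0.
  by rewrite expr0 mul1r subrr normr0 ltW.
by move=> i _; rewrite mulr0.
Qed.

(** Identity principle by induction: the constant term is the value at 0, and division by [q] leaves
    a series that again vanishes on the ball. *)
Lemma qseries_zero F c : has_qseries F c -> (forall q, qball q -> F q = 0) ->
  forall n, c n = 0.
Proof.
move=> Fc F0 n; elim: n F c Fc F0 => [|n IH] F c Fc F0.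
  by rewrite -(has_qseries0 Fc) F0 // /qball /= normr0.
have [F1 F1c] := subgeometric_has_qseries (subgeometric_shift (has_qseries_subgeometric Fc)).
apply: (IH F1 (fun n => c n.+1) F1c) => q qb.
have nz p : qball p -> p != 0 -> F1 p = 0.
  move=> pb p0; have e : p * F1 p = F p.
    have c0 : c 0%N = 0 by rewrite -(has_qseries0 Fc) F0 // /qball /= normr0.
    apply: (cvgn_unique (has_qseries_delay F1c pb)).
    apply: (has_qseries_eq Fc _ _ pb) => // -[|m] //=.
  move: e; rewrite F0 // => /eqP; rewrite qmulf_eq0 (negPf p0) /=.
  by move=> /eqP.
(* At the origin one cannot divide; the value there is compared with the zero values at small real
   points [d] by the Lipschitz bound. *)
have [->|q0] := eqVneq q 0; last exact: nz.
have h2 : 0 < 2^-1 :> R by rewrite invr_gt0.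
have [|K K0 lip] := qseries_lipschitz F1c h2; first by lra.
apply/eqP; rewrite -normr_le0; apply/ler_addgt0Pl => e e0; rewrite addr0.
have K1 : 0 < K + 1 by rewrite ltr_wpDl.
pose d := Num.min (2^-1) (e / (K + 1)).
have d0 : 0 < d by rewrite lt_min h2 divr_gt0.
have : d <= d by []; rewrite {2}/d le_min => /andP[d1 d2].
have nd : `|d%:A : H| = d by rewrite qnormA gtr0_norm.
have := lip 0 d%:A; rewrite normr0 nd (ltW h2) d1 => /(_ isT isT).
rewrite (nz d%:A); last 2 first.
- by rewrite /qball /= nd; lra.
- by apply/eqP => dA; move: d0; rewrite -nd dA normr0 ltxx.
rewrite subr0 sub0r normrN nd => h; apply: le_trans h _.
apply: (@le_trans _ _ ((K + 1) * d)); first by rewrite ler_wpM2r ?(ltW d0) // lerDl.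
by rewrite mulrC -ler_pdivlMr.
Qed.

Lemma qcoef_qseries f a : has_qseries f a -> qcoef f = a.
Proof.
move=> fa; have fb : has_qseries f (qcoef f) by exact: (xgetI (fun=> 0) fa).
have := has_qseriesD fa (has_qseriesZ (t := -1) fb).
move=> /qseries_zero h; apply/funext => n; apply/esym/eqP; rewrite -subr_eq0 -scaleN1r.
by rewrite h // => q _; rewrite scaleN1r subrr.
Qed.

Lemma qseries_has_qseries a : subgeometric a -> has_qseries (qseries a) a.
Proof.
move=> /subgeometric_has_qseries [f fa]; apply: (has_qseries_eq fa) => // q qb.
exact: (cvg_lim (@norm_hausdorff _ _) (fa q qb)).
Qed.

Lemma subgeometric_expr u : `|u| = 1 -> subgeometric (fun n => u ^+ n).
Proof.
move=> u1 r r0 r1; exists 1 => // n.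
by rewrite qnormX u1 expr1n mul1r exprn_ile1 // ltW.
Qed.

Lemma qconj_add_re u : u + qconj u = (2 * qre u)%:A.
Proof. by apply/quaternionP; split=> /=; ring. Qed.

Lemma unit_norm_quadratic u : `|u| = 1 -> u ^+ 2 - (2 * qre u) *: u + 1 = 0.
Proof.
move=> u1; have e : (2 * qre u) *: u = (u + qconj u) * u.
  by rewrite qconj_add_re -scalerAl mul1r.
by rewrite e mulrDl qconj_mul_norm u1 expr1n scale1r -expr2 opprD addrA subrr add0r addNr.
Qed.

Lemma has_qseries_linear u : has_qseries (fun q => 1 - q * u) (fun n =>
  const_coef 1 n - delay (const_coef u) n).
Proof.
have := has_qseriesD (has_qseries_const (k := 1)) (has_qseriesZ (t :=
  -1) (has_qseries_delay (has_qseries_const (k := u)))).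
by move=> h; apply: (has_qseries_eq h) => *; rewrite scaleN1r.
Qed.

(** The symmetrization of $1-qu$ is $D(q)=1-2\mathrm{Re}(u)q+q^2$. Its coefficients are real, so
    multiplying pointwise by [D] multiplies the series, and $u^2-2\mathrm{Re}(u)u+1=0$ gives
    $D(q)\sum q^nu^n=1-q\bar u$. On the ball [D] has no zero, since one would force $q\bar u=1$ and
    $|q|=1$. *)
Lemma regular_inv_qseries u : `|u| = 1 ->
  has_qseries (regular_inv (fun q => 1 - q * u)) (fun n => u ^+ n).
Proof.
move=> u1; set f := fun q => _.
pose lin v n := const_coef 1 n - delay (const_coef v) n.
have cf : qcoef f = lin u by apply: qcoef_qseries; exact: has_qseries_linear.
have hc : has_qseries (regular_conj f) (lin (qconj u)).
  have -> : lin (qconj u) = (fun n => qconj (qcoef f n)).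
    apply/funext => n; rewrite cf raddfB /=; congr (_ - _).
      by case: n => [|n] /=; rewrite ?qconj1 ?qconj0.
    by case: n => [|[|n]] /=; rewrite ?qconj0.
  apply: qseries_has_qseries; rewrite cf.
  have /has_qseries_subgeometric h := @has_qseries_linear u.
  move=> r r0 r1; have [K K0 hK] := h r r0 r1; exists K => // n; rewrite qnorm_conj.
  exact: hK.
have conjE q : qball q -> regular_conj f q = 1 - q * qconj u.
  by move=> qb; apply: (cvgn_unique (hc q qb)); exact: has_qseries_linear.
pose quad n := const_coef 1 n + (- (2 * qre u)) *: delay (const_coef 1) n + delay (delay
  (const_coef 1)) n.
pose D q := 1 + (- (2 * qre u)) *: (q * 1) + q * (q * 1).
have hD : has_qseries D quad.
  apply: has_qseriesD; last by do 2!apply: has_qseries_delay; exact: has_qseries_const.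
  apply: has_qseriesD; first exact: has_qseries_const.
  by apply: has_qseriesZ; apply: has_qseries_delay; exact: has_qseries_const.
have symE q : qball q -> symmetrization f q = D q.
  move=> qb; rewrite /symmetrization /regular_mul (qcoef_qseries hc) cf.
  have -> : (fun n => \sum_(k < n.+1) lin u k * lin (qconj u) (n - k)%N) = quad.
    apply/funext => -[|[|[|n]]]; rewrite /quad /lin.
    - rewrite big_ord_recl big_ord0 /=.
      by rewrite !subr0 mulr1 scaler0 !addr0.
    - rewrite !big_ord_recl big_ord0 /= !subr0 !sub0r !mul1r !mulr1 !addr0 add0r.
      by rewrite -opprD addrC qconj_add_re scaleNr.
    - rewrite !big_ord_recl big_ord0 /= !(subr0, sub0r, mulr0, mul0r, addr0, add0r, mulrNN).
      by rewrite qmul_conj_norm u1 expr1n scale1r scaler0 add0r.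
    rewrite !big_ord_recl big1 => [|i _]; last by rewrite /= subr0 mul0r.
    by rewrite /= !(subr0, sub0r, mulr0, mul0r, addr0, add0r, scaler0).
  exact: (cvg_lim (@norm_hausdorff _ _) (hD q qb)).
have [F0 hF0] := subgeometric_has_qseries (subgeometric_expr u1).
have DF q : qball q -> D q * F0 q = 1 - q * qconj u.
  move=> qb.
  have h := has_qseriesD (has_qseriesD hF0 (has_qseriesZ (t :=
    - (2 * qre u)) (has_qseries_delay hF0)))
    (has_qseries_delay (has_qseries_delay hF0)).
  have -> : D q * F0 q = F0 q + - (2 * qre u) *: (q * F0 q) + q * (q * F0 q).
    by rewrite /D !mulr1 !mulrDl mul1r -scalerAl -mulrA.
  suff h2 : has_qseries (fun q => F0 q + - (2 * qre u) *: (q * F0 q) + q * (q * F0 q))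
    (lin (qconj u)).
    exact: (cvgn_unique (h2 q qb) (has_qseries_linear qb)).
  apply: (has_qseries_eq h) => // -[|[|n]]; rewrite /lin /=.
  - by rewrite expr0 scaler0 !addr0 subr0.
  - rewrite expr0 expr1 scaleNr addr0 sub0r -qconj_add_re opprD addrA subrr add0r //.
  - rewrite subr0 2!exprS mulrA -expr2 exprS scaleNr scalerAl -mulNr -mulrDl.
    by rewrite -[X in _ + X]mul1r -mulrDl unit_norm_quadratic // mul0r.
apply: (has_qseries_eq hF0) => // q qb.
rewrite /regular_inv symE // conjE // -DF // mulKr // qunitE.
apply/eqP => D0; have := DF q qb; rewrite D0 mul0r => /esym/eqP.
rewrite subr_eq0 => /eqP e; have := qnorm1 R; rewrite e qnormM qnorm_conj u1 mulr1.
by move=> q1; move: qb; rewrite /qball /= q1 ltxx.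
Qed.

(** Powers of a single [u] multiply commutatively: the convolution square of $u^n$ has $n+1$ equal
    terms, and the outer factor [q] shifts the index. The predecessor at $n=0$ meets the coefficient
    0. *)
Lemma slice_koebe_qseries u : `|u| = 1 ->
  has_qseries (slice_koebe u) (fun n => n%:R *: u ^+ n.-1).
Proof.
move=> u1; have h := regular_inv_qseries u1.
have hs := subgeometric_natmul (subgeometric_expr u1).
have := has_qseries_delay (qseries_has_qseries hs).
move=> hk; apply: (has_qseries_eq hk) => [q qb|[|n]] /=; last 2 first.
- by rewrite scale0r.
- by [].
rewrite /slice_koebe /regular_mul (qcoef_qseries h); congr (_ * qseries _ q).
apply/funext => n; rewrite scaler_nat -[X in _ *+ X]card_ord -sumr_const.
by apply: eq_bigr => k _; rewrite -exprD subnKC // -ltnS.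
Qed.

End SeriesAlgebra.

(** * Starlikeness of the extremal functions *)

Section Extremal.
Variable R : realType.
Local Notation H := (quaternion R).
Implicit Types (s : nat -> H) (f F G : H -> H) (I J p q u w : H) (r t x y : R).

Lemma starlike_delay f F G s :
  has_qseries F s -> has_qseries G (fun n => n.+1%:R *: s n) -> s 0%N = 1 ->
  (forall q, qball q -> 0 < qre (qconj (F q) * G q)) ->
  has_qseries f (delay s) -> slice_starlike f.
Proof.
move=> Fs Gs s0 pos fs; apply: (slice_starlike_qseries fs Gs) => // q qb q0.
have -> : f q = q * F q by apply: (cvgn_unique (fs q qb)); exact: has_qseries_delay.
have h := pos q qb.
have F0 : F q != 0 by apply: contraTneq h => ->; rewrite qconj0 mul0r ltxx.
by rewrite qre_quotient_gt0.
Qed.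

Lemma sub1_neq0 w : `|w| < 1 -> 1 - w != 0.
Proof.
by apply: contraTneq => /eqP; rewrite subr_eq0 => /eqP <-; rewrite qnorm1 ltxx.
Qed.

(** As $T=(1-w)^{-1}(1+w)S$, cyclicity of the real part extracts $|S|^2$ and leaves
    $\mathrm{Re}((1-w)^{-1}(1+w))=(1-|w|^2)/|1-w|^2$. *)
Lemma cayley_pairing_gt0 w (S T : H) : `|w| < 1 -> S != 0 ->
  (1 - w) * T = (1 + w) * S -> 0 < qre (qconj S * T).
Proof.
move=> w1 S0 e; have w0 := sub1_neq0 w1.
have -> : T = (1 - w)^-1 * (1 + w) * S by rewrite -mulrA -e mulKr // qunitE.
rewrite mulrA qreMC mulrA qmul_conj_norm -scalerAl mul1r qreZ.
rewrite pmulr_rgt0 ?exprn_gt0 ?normr_gt0 //.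
rewrite -[(1 - w)^-1]/((qsqnorm (1 - w))^-1 *: qconj (1 - w)) -scalerAl qreZ.
rewrite pmulr_rgt0; last by rewrite invr_gt0 -qnorm_sqr exprn_gt0 // normr_gt0.
have -> : qre (qconj (1 - w) * (1 + w)) = 1 - `|w| ^+ 2.
  by rewrite qnorm_sqr /qsqnorm /=; ring.
by rewrite subr_gt0 expr_lt1.
Qed.

(** The series of $h$ and $f'$ for $f=q(1-q^2)^{-1}$, which has $a_2=0$ and $a_3=1$ and so attains
    the value 1. Here $(1-q^2)f'=(1+q^2)h$, a Cayley relation with $w=q^2$. *)
Lemma odd_function_series : exists F G : H -> H,
  [/\ has_qseries F (fun n => (~~ odd n)%:R),
      has_qseries G (fun n => n.+1%:R *: (~~ odd n)%:R) &
      forall q, qball q -> 0 < qre (qconj (F q) * G q)].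
Proof.
have hs : subgeometric (fun n => (~~ odd n)%:R : H).
  move=> r r0 r1; exists 1 => // n; case: (~~ _).
    by rewrite qnorm1 mul1r exprn_ile1 // ltW.
  by rewrite normr0 mul0r.
have [F Fs] := subgeometric_has_qseries hs.
have [G Gs] := subgeometric_has_qseries (subgeometric_natmul hs).
exists F, G; split=> // q qb.
have q2 : `|q ^+ 2| < 1 by rewrite qnormX expr_lt1.
have Fs2 := has_qseries_delay (has_qseries_delay Fs).
have Gs2 := has_qseries_delay (has_qseries_delay Gs).
apply: (cayley_pairing_gt0 q2).
  suff e : (1 - q ^+ 2) * F q = 1.
    by apply/eqP => F0; move: e; rewrite F0 mulr0 => /eqP; rewrite eq_sym oner_eq0.
  have h : has_qseries (fun q => F q + -1 *: (q * (q * F q))) (const_coef 1).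
    apply: (has_qseries_eq (has_qseriesD Fs (has_qseriesZ (t := -1) Fs2))) => // -[|[|n]] /=.
    - by rewrite scaler0 addr0.
    - by rewrite scaler0 addr0.
    - by rewrite negbK scaleN1r subrr.
  rewrite mulrBl mul1r expr2 -mulrA -scaleN1r.
  exact: (cvgn_unique (h q qb) (has_qseries_const qb)).
have h : has_qseries (fun q => G q + -1 *: (q * (q * G q)))
    (fun n => (~~ odd n)%:R + delay (delay (fun n => (~~ odd n)%:R)) n).
  apply: (has_qseries_eq (has_qseriesD Gs (has_qseriesZ (t := -1) Gs2))) => // -[|[|n]] /=.
  - by rewrite scaler0 scale1r.
  - by rewrite !scaler0.
  - rewrite negbK; case: (odd n); first by rewrite !scaler0 addr0.
    rewrite scalerA mulN1r -scalerDl.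
    have -> : n.+3%:R - n.+1%:R = 2 :> R by rewrite -(natr1 n.+2) -(natr1 n.+1); ring.
    by rewrite scaler_nat mulr2n.
rewrite mulrBl mulrDl !mul1r !expr2 -!mulrA -scaleN1r.
exact: (cvgn_unique (h q qb) (has_qseriesD Fs Fs2 qb)).
Qed.

Definition in_slice I q := exists x y, q = slice_pt I x y.

Lemma in_sliceM I p q : qimag_units I -> in_slice I p -> in_slice I q -> in_slice I (p * q).
Proof.
move=> hI [x [y ->]] [s [t ->]]; rewrite slice_ptM //.
by exists (x * s - y * t), (x * t + y * s).
Qed.

Lemma in_slice_conj I q : qimag_units I -> in_slice I q -> in_slice I (qconj q).
Proof. by move=> hI [x [y ->]]; rewrite slice_conj //; exists x, (- y). Qed.

Lemma in_slice_inv I q : qimag_units I -> in_slice I q -> in_slice I q^-1.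
Proof.
move=> hI hq; have [x [y e]] := in_slice_conj hI hq.
rewrite -[q^-1]/((qsqnorm q)^-1 *: qconj q) e.
exists ((qsqnorm q)^-1 * x), ((qsqnorm q)^-1 * y).
by rewrite /slice_pt scalerDr !scalerA.
Qed.

Lemma in_slice_comm I p q : in_slice I p -> in_slice I q -> p * q = q * p.
Proof. by move=> [x [y ->]] [s [t ->]]; exact: slice_pt_comm. Qed.

(** The case $u=1$. The closed form of [F] shows that it has no zero and stays in the slice of [w];
    the second relation gives the same slice for [G] and the Cayley positivity. *)
Lemma koebe_kernels : exists F G : H -> H,
  [/\ has_qseries F (fun n => n.+1%:R *: 1),
      has_qseries G (fun n => n.+1%:R *: (n.+1%:R *: 1)) &
      forall w, qball w ->
        [/\ F w = (1 - w)^-1 * (1 - w)^-1 & (1 - w) * G w = (1 + w) * F w]].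
Proof.
have hs : subgeometric (fun n => 1 ^+ n : H) by apply: subgeometric_expr; rewrite qnorm1.
have {}hs : subgeometric (fun=> 1 : H).
  by move=> r r0 r1; have [K K0 hK] := hs r r0 r1; exists K => // n; have := hK n; rewrite expr1n.
have [E Es] := subgeometric_has_qseries hs.
have [F Fs] := subgeometric_has_qseries (subgeometric_natmul hs).
have [G Gs] := subgeometric_has_qseries (subgeometric_natmul (subgeometric_natmul hs)).
exists F, G; split=> // w wb; have w0 := sub1_neq0 wb.
have e1 : (1 - w) * E w = 1.
  have h : has_qseries (fun q => E q + -1 *: (q * E q)) (const_coef 1).
    apply: (has_qseries_eq (has_qseriesD Es (has_qseriesZ (t :=
      -1) (has_qseries_delay Es)))) => // -[|n] /=.
      by rewrite scaler0 addr0.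
    by rewrite scaleN1r subrr.
  rewrite mulrBl mul1r -scaleN1r.
  exact: (cvgn_unique (h w wb) (has_qseries_const wb)).
have e2 : (1 - w) * F w = E w.
  have h : has_qseries (fun q => F q + -1 *: (q * F q)) (fun=> 1).
    apply: (has_qseries_eq (has_qseriesD Fs (has_qseriesZ (t :=
      -1) (has_qseries_delay Fs)))) => // -[|n] /=.
      by rewrite scaler0 addr0 scale1r.
    by rewrite scaleN1r -scalerBl -natrB // subSnn scale1r.
  rewrite mulrBl mul1r -scaleN1r.
  exact: (cvgn_unique (h w wb) (Es w wb)).
split.
  rewrite -[F w]mul1r -[1 in LHS](mulVr (x := 1 - w)) ?qunitE // -mulrA e2.
  by congr (_ * _); rewrite -[LHS]mul1r -[1 in LHS](mulVr (x := 1 - w)) ?qunitE // -mulrA e1 mulr1.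
have h : has_qseries (fun q => G q + -1 *: (q * G q)) (fun n => n.+1%:R *: 1 + delay (fun n =>
  n.+1%:R *: 1) n).
  apply: (has_qseries_eq (has_qseriesD Gs (has_qseriesZ (t :=
    -1) (has_qseries_delay Gs)))) => // -[|n] /=.
    by rewrite scaler0 !scale1r.
  rewrite !scalerA mulN1r -!scalerDl; congr (_ *: _).
  by rewrite -(natr1 n.+1); ring.
rewrite mulrBl mulrDl !mul1r -scaleN1r.
exact: (cvgn_unique (h w wb) (has_qseriesD Fs (has_qseries_delay Fs) wb)).
Qed.

(* [E = 1 - IJ] satisfies [E J = I E], so that right powers of [x + yJ]
   become left powers of [x + yI]. *)
Lemma intertwine I J x y n : qimag_units I -> qimag_units J ->
  (1 - I * J) * slice_pt J x y ^+ n = slice_pt I x y ^+ n * (1 - I * J).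
Proof.
move=> hI hJ; elim: n => [|n IH]; first by rewrite !expr0 mulr1 mul1r.
rewrite exprS mulrA; have -> : (1 - I * J) * slice_pt J x y = slice_pt I x y * (1 - I * J).
  have I2 : I * I = -1 := hI; have J2 : J * J = -1 := hJ.
  rewrite /slice_pt [LHS]mulrDr [RHS]mulrDl -scalerAr -scalerAr -!scalerAl mulr1 mul1r.
  congr (_ + y *: _).
  rewrite mulrBl mulrBr mul1r mulr1 -mulrA J2 mulrA I2 mulrN1 mulN1r.
  by rewrite !opprK addrC.
by rewrite -mulrA IH mulrA -exprS.
Qed.

(** The factors $E=1-IJ$ and $D=1+IJ$ add up to 2, so $2u^n=v^nE+z^nD$ with $v,z=c\pm sI$ in the
    slice of [q]. Both series become combinations of the kernels at $qv$ and $qz$. The cross terms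
    vanish, leaving positive numbers weighted by $|E|^2$ and $|D|^2$, which are not both 0. *)
Lemma koebe_pairing_gt0 u F G q : `|u| = 1 ->
  has_qseries F (fun n => n.+1%:R *: u ^+ n) ->
  has_qseries G (fun n => n.+1%:R *: (n.+1%:R *: u ^+ n)) ->
  qball q -> 0 < qre (qconj (F q) * G q).
Proof.
move=> u1 Fs Gs qb.
have [I [x [y [hI eq]]]] := slice_ptP q.
have [J [c [s [hJ eu]]]] := slice_ptP u.
have cs : c ^+ 2 + s ^+ 2 = 1 by rewrite -(slice_norm c s hJ) -eu u1 expr1n.
pose v := slice_pt I c s; pose z := slice_pt I c (- s).
pose E := 1 - I * J; pose D := 1 - (- I) * J.
have DE : D + E = 2 *: 1 by rewrite /D /E mulNr opprK addrACA subrr addr0 -mulr2n scaler_nat.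
have nv : `|v| = 1.
  by apply/eqP; rewrite -(eqrXn2 (n := 2)) // expr1n slice_norm // cs.
have nz : `|z| = 1.
  by apply/eqP; rewrite -(eqrXn2 (n := 2)) // expr1n slice_norm // sqrrN cs.
have Eu n : E * u ^+ n = v ^+ n * E by rewrite eu; exact: intertwine.
have Du n : D * u ^+ n = z ^+ n * D.
  have -> : z = slice_pt (- I) c s by rewrite /z /slice_pt scaleNr scalerN.
  by rewrite eu; apply: intertwine => //; exact: imag_opp.
have qI : in_slice I q by exists x, y.
have vI : in_slice I v by exists c, s.
have zI : in_slice I z by exists c, (- s).
have qvb : qball (q * v) by rewrite /qball /= qnormM nv mulr1.
have qzb : qball (q * z) by rewrite /qball /= qnormM nz mulr1.
(* The real weight [t] is $n+1$ for [F] and $(n+1)^2$ for [G]. As [q] commutes with [v] and [z],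
   $q^nv^n=(qv)^n$ and $q^nz^n=(qz)^n$. *)
have split_series (t : nat -> R) (S T : H -> H) : has_qseries S (fun n => t n *: u ^+ n) ->
    has_qseries T (fun n => t n *: 1) -> 2 *: S q = T (q * v) * E + T (q * z) * D.
  move=> hS hT; pose W w N := series (fun n => w ^+ n * (t n *: 1)) N.
  have h : (fun N => W (q * v) N * E + W (q * z) N * D) @ \oo --> T (q * v) * E + T (q * z) * D.
    by apply: cvgD; apply: cvg_qmulr; exact: hT.
  have := cvg_qmull (q := 2 *: 1) (hS q qb).
  rewrite -[X in _ --> X -> _]scalerAl mul1r => h2; apply: (cvgn_unique h2).
  suff -> : (fun N => 2 *: 1 * series (fun n => q ^+ n * (t n *: u ^+ n)) N) =
     (fun N => W (q * v) N * E + W (q * z) N * D) by exact: h.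
  apply/funext => N; rewrite /W /series /= mulr_sumr !mulr_suml -big_split /=.
  apply: eq_bigr => n _.
  rewrite !exprMn_comm; [|exact: in_slice_comm qI zI|exact: in_slice_comm qI vI].
  rewrite -!scalerAr !mulr1 -!scalerAl mul1r -!mulrA -Eu -Du -scalerDr -mulrDr -mulrDl.
  by rewrite [E + D]addrC DE -scalerAl mul1r -!scalerAr scalerA mulrC -scalerA.
have [k1 [k2 [h1 h2 hk]]] := koebe_kernels.
have F2 := split_series _ _ _ Fs h1.
have G2 : 2 *: G q = k2 (q * v) * E + k2 (q * z) * D.
  apply: (split_series (fun n => n.+1%:R * n.+1%:R)).
    by apply: (has_qseries_eq Gs) => // n; rewrite scalerA.
  by apply: (has_qseries_eq h2) => // n; rewrite scalerA.
have one : in_slice I 1 by exists 1, 0; rewrite /slice_pt scale1r scale0r addr0.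
have subI w : in_slice I w -> in_slice I (1 - w).
  move=> [s' [t' ->]]; exists (1 - s'), (- t').
  by rewrite /slice_pt scalerBl scale1r scaleNr opprD addrA.
have addI w : in_slice I w -> in_slice I (1 + w).
  move=> [s' [t' ->]]; exists (1 + s'), t'.
  by rewrite /slice_pt scalerDl scale1r addrA.
have k1I w : qball w -> in_slice I w -> in_slice I (k1 w).
  move=> wb wI; have [-> _] := hk w wb.
  by apply: in_sliceM => //; apply: in_slice_inv => //; exact: subI.
have k2I w : qball w -> in_slice I w -> in_slice I (k2 w).
  move=> wb wI; have [_ e] := hk w wb.
  rewrite -[k2 w]mul1r -(mulVr (x := 1 - w)) ?qunitE ?sub1_neq0 // -mulrA e.
  apply: in_sliceM => //; first by apply: in_slice_inv => //; exact: subI.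
  by apply: in_sliceM => //; [exact: addI | exact: k1I].
have k12 w : qball w -> 0 < qre (qconj (k1 w) * k2 w).
  move=> wb; have [e1 e2] := hk w wb; apply: (cayley_pairing_gt0 wb) => //.
  by rewrite e1 qmulf_eq0 orbb -normr_eq0 qnormV invr_eq0 normr_eq0 sub1_neq0.
have qvI : in_slice I (q * v) by exact: in_sliceM.
have qzI : in_slice I (q * z) by exact: in_sliceM.
have diag (A B C : H) : qre (qconj (A * C) * (B * C)) = `|C| ^+ 2 * qre (qconj A * B).
  rewrite qconjM -mulrA qreMC !mulrA -(mulrA _ C) qmul_conj_norm.
  by rewrite -scalerAr mulr1 qreZ.
(* Cyclicity brings the cross term to an element of the slice of [I] times [C' * qconj C]. For [E]
   and [D] the latter is $\pm(IJ-JI)$, a multiple of the vector product of [I] and [J], so its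
   product with 1 or [I] has real part 0. *)
have cross (A B C C' : H) : in_slice I A -> in_slice I B ->
    (forall x' y' : R, qre (slice_pt I x' y' * (C' * qconj C)) = 0) ->
    qre (qconj (A * C) * (B * C')) = 0.
  move=> hA hB hC; have [s' [t' e]] := in_sliceM hI (in_slice_conj hI hA) hB.
  by rewrite qconjM -mulrA qreMC -!mulrA mulrA e hC.
have I2 : I * I = -1 := hI; have J2 : J * J = -1 := hJ.
have [I0 _] := (imag_unitP I).1 hI; have [J0 _] := (imag_unitP J).1 hJ.
have cE : qconj E = 1 - J * I.
  by rewrite /E raddfB /= qconj1 qconjM !imag_conj // mulrNN.
have cD : qconj D = 1 + J * I.
  by rewrite /D mulNr opprK raddfD /= qconj1 qconjM !imag_conj // mulrNN.
have ED : E * qconj D = J * I - I * J.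
  rewrite cD /E mulrBl mul1r mulrDr mulr1 mulrA -(mulrA I J J) J2 mulrN1 mulNr I2 opprK.
  by move: (J * I) (I * J) => b c'; apply/quaternionP; split=> /=; ring.
have DE' : D * qconj E = I * J - J * I.
  rewrite cE /D mulNr opprK mulrDl mul1r mulrBr mulr1 mulrA -(mulrA I J J) J2 mulrN1 mulNr I2 opprK.
  by move: (J * I) (I * J) => b c'; apply/quaternionP; split=> /=; ring.
have orth (x' y' : R) : qre (slice_pt I x' y' * (I * J - J * I)) = 0.
  by rewrite /= I0 J0; ring.
have : qre (qconj (2 *: F q) * (2 *: G q)) = 4 * qre (qconj (F q) * G q).
  by rewrite qconjZ -scalerAl -scalerAr !qreZ mulrA; congr (_ * _); ring.
have expand (A B C C' : H) : qre (qconj (A + B) * (C + C')) =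
    qre (qconj A * C) + qre (qconj B * C') + (qre (qconj A * C') + qre (qconj B * C)).
  by rewrite /=; ring.
clearbody v z E D.
rewrite F2 G2 expand (diag (k1 (q * v)) (k2 (q * v)) E) (diag (k1 (q * z)) (k2 (q * z)) D).
rewrite (cross (k1 (q * v)) (k2 (q * z)) E D); last first.
- by move=> x' y'; rewrite DE' orth.
- exact: k2I.
- exact: k1I.
rewrite (cross (k1 (q * z)) (k2 (q * v)) D E); last first.
- move=> x' y'; rewrite ED -[J * I - I * J]opprB mulrN.
  by rewrite -[LHS]/(- qre (slice_pt I x' y' * (I * J - J * I))) orth oppr0.
- exact: k2I.
- exact: k1I.
rewrite !addr0 => h.
have p1 := k12 _ qvb; have p2 := k12 _ qzb.
have : 0 < `|E| ^+ 2 * qre (qconj (k1 (q * v)) * k2 (q * v)) +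
           `|D| ^+ 2 * qre (qconj (k1 (q * z)) * k2 (q * z)).
  have [E0|E0] := eqVneq E 0; last first.
    by apply: ltr_pwDl; [rewrite mulr_gt0 // exprn_gt0 // normr_gt0 | rewrite mulr_ge0
      ?exprn_ge0 // ltW].
  have D0 : D != 0.
    apply/eqP => D0; move: DE; rewrite D0 E0 addr0 => /esym/eqP.
    by rewrite scaler_eq0 oner_eq0 pnatr_eq0.
  by apply: ltr_wpDl; [rewrite mulr_ge0 ?exprn_ge0 // ltW | rewrite mulr_gt0 // exprn_gt0 //
    normr_gt0].
by rewrite h pmulr_rgt0.
Qed.

Lemma koebe_starlike u f : `|u| = 1 -> (forall q, qball q -> f q = slice_koebe u q) ->
  slice_starlike f /\ has_qseries f (delay (fun n => n.+1%:R *: u ^+ n)).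
Proof.
move=> u1 fk; have fs : has_qseries f (delay (fun n => n.+1%:R *: u ^+ n)).
  by apply: (has_qseries_eq (slice_koebe_qseries u1)) => // -[|n] //=; rewrite scale0r.
split=> //; have hs := subgeometric_natmul (subgeometric_expr u1).
have [F Fs] := subgeometric_has_qseries hs.
have [G Gs] := subgeometric_has_qseries (subgeometric_natmul hs).
apply: (starlike_delay Fs Gs _ _ fs); first by rewrite expr0 scale1r.
by move=> q; exact: koebe_pairing_gt0 u1 Fs Gs.
Qed.

Lemma delay_expansion f s : s 0%N = 1 -> has_qseries f (delay s) ->
  forall q, qball q -> (fun N => q + \sum_(2 <= n < N) q ^+ n * delay s n) @ \oo --> f q.
Proof.
move=> s0 fs; apply/normalized_has_qseries.
by apply: (has_qseries_eq fs) => // -[|[|n]] //=.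
Qed.

Lemma koebe_coef_norm u (lam : H) : `|u| = 1 ->
  `|3%:R *: u ^+ 2 - lam * (2%:R *: u ^+ 1) ^+ 2| = `|4 * lam - 3|.
Proof.
move=> u1; rewrite -normrN.
have -> : - (3%:R *: u ^+ 2 - lam * (2%:R *: u ^+ 1) ^+ 2) = (4 * lam - 3) * u ^+ 2.
  by rewrite expr1; apply/quaternionP; split=> /=; ring.
by rewrite qnormM qnormX u1 expr1n mulr1.
Qed.

End Extremal.

(** For the Koebe function the functional equals $(3-4\lambda)u^2$, of modulus $|4\lambda-3|$, which
    is the maximum exactly when it is at least 1; this is the condition put on the equality clause.
    When $|4\lambda-3|\le1$, sharpness comes from $q(1-q^2)^{-1}$. *)
Theorem theorem1p2 (R : realType) (lam : quaternion R) :
  (forall (f : quaternion R -> quaternion R) (a : nat -> quaternion R),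
     slice_starlike f ->
     (forall q : quaternion R, qball q ->
        (fun N : nat => q + \sum_(2 <= n < N) q ^+ n * a n) @ \oo --> f q) ->
     `|a 3%N - lam * a 2%N ^+ 2| <= Num.max 1 `|4 * lam - 3|)
  /\
  (exists (f : quaternion R -> quaternion R) (a : nat -> quaternion R),
     [/\ slice_starlike f,
         (forall q : quaternion R, qball q ->
            (fun N : nat => q + \sum_(2 <= n < N) q ^+ n * a n) @ \oo --> f q) &
         `|a 3%N - lam * a 2%N ^+ 2| = Num.max 1 `|4 * lam - 3|])
  /\
  (1 <= `|4 * lam - 3| ->
   forall u : quaternion R, `|u| = 1 ->
   forall f : quaternion R -> quaternion R,
     (forall q : quaternion R, qball q -> f q = slice_koebe u q) ->
     slice_starlike f /\
     exists a : nat -> quaternion R,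
       (forall q : quaternion R, qball q ->
          (fun N : nat => q + \sum_(2 <= n < N) q ^+ n * a n) @ \oo --> f q) /\
       `|a 3%N - lam * a 2%N ^+ 2| = Num.max 1 `|4 * lam - 3|).
Proof.
have koebe : 1 <= `|4 * lam - 3| -> forall u : quaternion R, `|u| = 1 ->
    forall f, (forall q, qball q -> f q = slice_koebe u q) ->
    slice_starlike f /\ exists a : nat -> quaternion R,
      (forall q : quaternion R, qball q ->
         (fun N : nat => q + \sum_(2 <= n < N) q ^+ n * a n) @ \oo --> f q) /\
      `|a 3%N - lam * a 2%N ^+ 2| = Num.max 1 `|4 * lam - 3|.
  move=> lam1 u u1 f /(koebe_starlike u1) [star fs]; split=> //.
  exists (delay (fun n => n.+1%:R *: u ^+ n)); split.
    by apply: delay_expansion => //; rewrite expr0 scale1r.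
  rewrite -[LHS]/(`|3%:R *: u ^+ 2 - lam * (2%:R *: u ^+ 1) ^+ 2|).
  by rewrite koebe_coef_norm //; apply/esym/max_idPr.
split; first by move=> f a; exact: fekete_szego.
split=> //; have /orP[lam1|lam1] := le_total 1 `|4 * lam - 3|.
  have [star [a [fa e]]] := koebe lam1 1 (qnorm1 R) (slice_koebe 1) (fun _ _ => erefl).
  by exists (slice_koebe 1), a.
have [F [G [Fs Gs pos]]] := odd_function_series R.
have fs := has_qseries_delay Fs.
exists (fun q => q * F q), (delay (fun n => (~~ odd n)%:R)); split.
- by apply: starlike_delay Fs Gs _ pos fs.
- by apply: delay_expansion fs.
- rewrite /= expr0n /= mulr0 subr0 qnorm1; apply/esym/max_idPl; exact: lam1.
Qed.
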